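(* Let $H$ be a Bredon $\mathrm{el}_2^{RO}$-algebra, and let $(X,a)$ be an orientable $\mathrm{el}_2^{RO}$-algebra. (i) Evaluation at the unique inverse Thom class of $H$ is a bijection between the set of morphisms of orientable $\mathrm{el}_2^{RO}$-algebras from $H$ to $X$, and the set of those inverse Thom classes $t$ of $X$ such that $(X,a,t)$ is additive. (ii) Any two Bredon $\mathrm{el}_2^{RO}$-algebras are uniquely isomorphic (as orientable $\mathrm{el}_2^{RO}$-algebras).
   Context: Write $C=\{\pm1\}$. An elementary abelian 2-group is a finite group isomorphic to $C^n$ for some $n\ge 0$. Representations are finite-dimensional and real. A character of $A$ is a homomorphism $\lambda:A\to C$, identified with the 1-dimensional representation on $\mathbb R$ with $g\cdot x=\lambda(g)x$ and with its class in the real representation ring $RO(A)$; $\sigma$ is the sign representation of $C$ (the identity character). For a finite group $G$ put $I_G=\{k-V: k\in\mathbb Z,\ V \text{ a } G\text{-representation}\}\subset RO(G)$. The category $\mathrm{el}_2^{RO}$ has objects the pairs $(A,m)$ with $A$ an elementary abelian 2-group and $m\in I_A$; morphisms $(B,n)\to(A,m)$ are group homomorphisms $\alpha:B\to A$ with $\alpha^*(m)=n$. It is symmetric monoidal under $(A,m)\times(B,n)=(A\times B,\,p_1^*(m)+p_2^*(n))$ with unit $(1,0)$. An $\mathrm{el}_2^{RO}$-algebra is a lax symmetric monoidal functor $X:(\mathrm{el}_2^{RO})^{\mathrm{op}}\to(\mathbb F_2\text{-vector spaces},\otimes)$; morphisms are monoidal transformations. Write $\alpha^*:X(A,m)\to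 X(B,\alpha^*(m))$ for the restriction maps, and $\mathrm{res}^A_B$ for restriction to a subgroup. Composing the monoidal pairing with restriction along the diagonal of $A$ gives products $X(A,m)\otimes X(A,n)\to X(A,m+n)$, making $X(A,\star)$ a commutative $I_A$-graded $\mathbb F_2$-algebra. An orientable $\mathrm{el}_2^{RO}$-algebra is a pair $(X,a)$ with $a\in X(C,-\sigma)$ (the pre-Euler class) such that for every elementary abelian 2-group $A$, every $m\in I_A$ and every nontrivial character $\lambda$ of $A$ with kernel $K$, the sequence $$0\to X(A,m)\xrightarrow{a_\lambda\cdot-}X(A,m-\lambda)\xrightarrow{\mathrm{res}^A_K}X(K,\mathrm{res}^A_K(m)-1)\to 0$$ is exact, where $a_\lambda=\lambda^*(a)$. Morphisms of orientable $\mathrm{el}_2^{RO}$-algebras are morphisms of $\mathrm{el}_2^{RO}$-algebras preserving the pre-Euler class. An inverse Thom class is a class $t\in X(C,1-\sigma)$ with $\mathrm{res}^C_1(t)=1\in X(1,0)$; put $t_\lambda=\lambda^*(t)$. The oriented $\mathrm{el}_2^{RO}$-algebra $(X,a,t)$ is additive if $$a_1t_\mu t_2+t_1a_\mu t_2+t_1t_\mu a_2=0\quad\text{in } X(C\times C,2-(p_1\oplus\mu\oplus p_2)),$$ where $p_1,p_2,\mu:C\times C\to C$ are the two projections and the multiplication, and $a_i=a_{p_i}$, $t_i=t_{p_i}$. A Bredon $\mathrm{el}_2^{RO}$-algebra is an orientable $\mathrm{el}_2^{RO}$-algebra $H$ such that for every elementary abelian 2-group $A$ and $k\in\mathbb Z$,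 $H(A,k)=\mathbb F_2$ if $k=0$ and $H(A,k)=0$ if $k\neq0$. The pre-Euler class and the inverse Thom class of a Bredon $\mathrm{el}_2^{RO}$-algebra are unique. *)

(* Defs.v *)
From HB Require Import structures.
From mathcomp Require Import all_boot all_order all_algebra.
From mathcomp Require Import all_fingroup all_solvable.
From mathcomp Require Import mxrepresentation character.
From mathcomp Require Import generic_quotient ring_quotient.
From mathcomp Require Import boolp reals.
From mathcomp.multinomials Require Import freeg.

Set Implicit Arguments.
Unset Strict Implicit.
Unset Printing Implicit Defensive.

Import GRing.Theory.

Local Open Scope ring_scope.
Local Open Scope quotient_scope.

Notation rrep R G := (representation R [set: G]%G).

Section Pullback.
Variables (R : realType) (H G : finGroupType) (f : {multiplicative H -> G}).

Lemma ghom1 : f 1%g = 1%g.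
Proof. by apply: (mulgI (f 1%g)); rewrite -gmulfM !mulg1. Qed.

Lemma pbrep_subproof (V : rrep R G) :
  mx_repr [set: H]%G (fun h => mx_repr_of_repr V (f h)).
Proof.
split=> [|x y _ _]; first by rewrite ghom1 repr_mx1.
by rewrite gmulfM repr_mxM ?inE.
Qed.

Definition pbrep (V : rrep R G) : rrep R H :=
  Representation (MxRepresentation (pbrep_subproof V)).

Lemma pbrep_rsim (V W : rrep R G) :
  mx_rsim V W -> mx_rsim (pbrep V) (pbrep W).
Proof.
case=> B eqVW freeB homB; exists B => // h _; by apply: homB; rewrite inE.
Qed.

Lemma pbrep_dadd (V W : rrep R G) :
  mx_rsim (pbrep (dadd_grepr V W)) (dadd_grepr (pbrep V) (pbrep W)).
Proof.
exists 1%:M; [by []|by rewrite row_free_unit unitmx1|move=> h _ /=].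
by rewrite mulmx1 mul1mx.
Qed.

End Pullback.

Section StandardReps.
Variables (R : realType) (G : finGroupType).

Lemma triv1_subproof : mx_repr [set: G]%G (fun _ => 1%:M : 'M[R]_1).
Proof. by split=> // x y _ _; rewrite mulmx1. Qed.

Definition triv1 : rrep R G := Representation (MxRepresentation triv1_subproof).

End StandardReps.

(* [RO R G] is the real representation ring, as an additive group (its product
   is not needed): the free abelian group on the real representations of [G],
   modulo the subgroup [RO_rel] generated by [V] - [W] for isomorphic V and W,
   and by [V (+) W] - [V] - [W]. *)
Section RO.
Variables (R : realType) (G : finGroupType).

Notation repT := {classic rrep R G}.
Notation freerep := {freeg repT / int}.

Definition frgen (V : rrep R G) : freerep := << (V : repT) >>.

Inductive RO_rel : freerep -> Prop :=
| RO_rel0 : RO_rel 0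
| RO_relB D E : RO_rel D -> RO_rel E -> RO_rel (D - E)
| RO_rel_iso (V W : rrep R G) : mx_rsim V W -> RO_rel (frgen V - frgen W)
| RO_rel_dadd (V W : rrep R G) :
    RO_rel (frgen (dadd_grepr V W) - frgen V - frgen W).

Definition RO_sub : {pred freerep} := fun D => `[< RO_rel D >].

Lemma RO_sub_zmod : zmod_closed RO_sub.
Proof.
split; first exact/asboolP/RO_rel0.
by move=> D E /asboolP rD /asboolP rE; apply/asboolP/RO_relB.
Qed.

HB.instance Definition _ := GRing.isZmodClosed.Build freerep RO_sub RO_sub_zmod.

Definition RO := Quotient.quot (RO_sub : zmodClosed freerep).
HB.instance Definition _ := GRing.Zmodule.on RO.

Definition piRO (D : freerep) : RO :=
  \pi_(Quotient.quot (RO_sub : zmodClosed freerep)) D.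

Lemma piRO_zmod_morphism : zmod_morphism piRO.
Proof. by move=> D E; rewrite /piRO [LHS]raddfB. Qed.
HB.instance Definition _ :=
  GRing.isZmodMorphism.Build freerep RO piRO piRO_zmod_morphism.

Lemma piROP (D E : freerep) : piRO D = piRO E <-> RO_rel (D - E).
Proof.
split=> [/eqP|rDE]; first by rewrite -Quotient.idealrBE => /asboolP.
by apply/eqP; rewrite -Quotient.idealrBE; apply/asboolP.
Qed.

Lemma piRO_surj (m : RO) : exists D, m = piRO D.
Proof. by exists (repr m); rewrite /piRO reprK. Qed.

Definition rclass (V : rrep R G) : RO := piRO (frgen V).

Lemma rclass_rsim (V W : rrep R G) : mx_rsim V W -> rclass V = rclass W.
Proof. by move=> simVW; apply/piROP/RO_rel_iso. Qed.

Lemma rclass_dadd (V W : rrep R G) :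
  rclass (dadd_grepr V W) = rclass V + rclass W.
Proof.
rewrite /rclass -raddfD; apply/piROP.
by rewrite opprD addrA; apply: RO_rel_dadd.
Qed.

Lemma rclass0 : rclass grepr0 = 0.
Proof.
have /rclass_rsim: mx_rsim (dadd_grepr grepr0 grepr0 : rrep R G) grepr0.
  by exists 0 => // [|g _]; rewrite ?mul0mx ?mulmx0 // /row_free mxrank0.
by rewrite rclass_dadd => /eqP; rewrite -subr_eq0 addrK => /eqP.
Qed.

Lemma RO_additive_ext (Z : zmodType) (f g : {additive RO -> Z}) :
  (forall V, f (rclass V) = g (rclass V)) -> f =1 g.
Proof.
move=> eq_fg m; have [D ->] := piRO_surj m.
elim/freeg_ind_dom0: D => [|k V D _ _ IH]; first by rewrite !raddf0.
rewrite !raddfD IH; congr (_ + _).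
have ->: << k *g V >> = (frgen V) *~ k :> freerep.
  rewrite -scaler_int; apply/eqP/freeg_eqP=> W.
  by rewrite coeff_fgscale !coeffU mul1r intz.
by rewrite !raddfMz; congr (_ *~ _); apply: eq_fg.
Qed.

End RO.

Section PullbackRO.
Variables (R : realType) (H G : finGroupType) (f : {multiplicative H -> G}).

Notation freerep A := {freeg {classic rrep R A} / int}.

Definition pbfree : freerep G -> freerep H :=
  fglift (fun V : {classic rrep R G} => frgen (pbrep f V)).

Lemma pbfree_zmod_morphism : zmod_morphism pbfree.
Proof. exact: lift_is_additive. Qed.
HB.instance Definition _ :=
  GRing.isZmodMorphism.Build _ _ pbfree pbfree_zmod_morphism.

Lemma pbfree_gen (V : rrep R G) : pbfree (frgen V) = frgen (pbrep f V).
Proof. by rewrite /pbfree /frgen liftU scale1r. Qed.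

Lemma RO_rel_pbfree (D : freerep G) : RO_rel D -> RO_rel (pbfree D).
Proof.
elim=> [|{}D E _ rD _ rE|V W simVW|V W]; rewrite ?raddf0 ?raddfB /=.
- exact: RO_rel0.
- exact: RO_relB.
- by rewrite !pbfree_gen; apply/RO_rel_iso/pbrep_rsim.
rewrite !pbfree_gen; apply/piROP; rewrite raddfB /=.
apply/eqP; rewrite subr_eq addrC -rclass_dadd; apply/eqP.
exact/rclass_rsim/pbrep_dadd.
Qed.

(* [pbfree] descends to the quotients; see [pbROE]. *)
Definition pbRO (m : RO R G) : RO R H := piRO (pbfree (repr m)).

Lemma pbROE (D : freerep G) : pbRO (piRO D) = piRO (pbfree D).
Proof.
apply/piROP; rewrite -raddfB; apply/RO_rel_pbfree/piROP.
by rewrite /piRO reprK.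
Qed.

Lemma pbRO_zmod_morphism : zmod_morphism pbRO.
Proof.
move=> m n; have [D ->] := piRO_surj m; have [E ->] := piRO_surj n.
by rewrite -raddfB !pbROE !raddfB.
Qed.
HB.instance Definition _ :=
  GRing.isZmodMorphism.Build (RO R G) (RO R H) pbRO pbRO_zmod_morphism.

Lemma pbRO_rclass (V : rrep R G) : pbRO (rclass V) = rclass (pbrep f V).
Proof. by rewrite /rclass pbROE pbfree_gen. Qed.

End PullbackRO.

Section PullbackROTheory.
Variable R : realType.

Lemma pbRO_ext (H G : finGroupType) (f g : {multiplicative H -> G}) :
  f =1 g -> @pbRO R H G f =1 pbRO g.
Proof.
move=> eq_fg; apply: RO_additive_ext => V /=; rewrite !pbRO_rclass.
apply: rclass_rsim; exists 1%:M => [//||h _ /=].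
  by rewrite row_free_unit unitmx1.
by rewrite eq_fg mulmx1 mul1mx.
Qed.

Lemma pbRO_id (G : finGroupType) (m : RO R G) : pbRO idfun m = m.
Proof.
apply: (RO_additive_ext (g := idfun)) => V /=; rewrite pbRO_rclass.
apply: rclass_rsim; exists 1%:M => [//||h _ /=].
  by rewrite row_free_unit unitmx1.
by rewrite mulmx1 mul1mx.
Qed.

Lemma pbRO_comp (K H G : finGroupType) (g : {multiplicative H -> G})
    (f : {multiplicative K -> H}) (m : RO R G) :
  pbRO (g \o f) m = pbRO f (pbRO g m).
Proof.
apply: (RO_additive_ext (g := pbRO f \o pbRO g)) => V /=.
rewrite !pbRO_rclass; apply: rclass_rsim; exists 1%:M => [//||h _ /=].
  by rewrite row_free_unit unitmx1.
by rewrite mulmx1 mul1mx.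
Qed.

End PullbackROTheory.

Section IRO.
Variables (R : realType) (G : finGroupType).

(* The class k - V. *)
Definition subRO (k : int) (V : rrep R G) : RO R G :=
  rclass (triv1 R G) *~ k - rclass V.

Definition in_IRO : {pred RO R G} := fun m => `[< exists k V, m = subRO k V >].

Lemma subROD k l V W : subRO k V + subRO l W = subRO (k + l) (dadd_grepr V W).
Proof. by rewrite /subRO rclass_dadd mulrzDr opprD addrACA. Qed.

Lemma subRO0 : subRO 0 grepr0 = 0.
Proof. by rewrite /subRO rclass0 subr0 mulr0z. Qed.

Lemma in_IRO_addr_closed : addr_closed in_IRO.
Proof.
split; first by apply/asboolP; exists 0, grepr0; rewrite subRO0.
move=> _ _ /asboolP[k [V ->]] /asboolP[l [W ->]]; apply/asboolP.
by exists (k + l), (dadd_grepr V W); rewrite subROD.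
Qed.
HB.instance Definition _ :=
  GRing.isAddClosed.Build (RO R G) in_IRO in_IRO_addr_closed.

Record IRO := MkIRO { ro_of :> RO R G; _ : in_IRO ro_of }.
HB.instance Definition _ := [isSub for ro_of].
HB.instance Definition _ := [Choice of IRO by <:].
HB.instance Definition _ :=
  GRing.SubChoice_isSubNmodule.Build _ _ IRO in_IRO_addr_closed.

Lemma subI_subproof k V : subRO k V \in in_IRO.
Proof. by apply/asboolP; exists k, V. Qed.
Definition subI (k : int) (V : rrep R G) : IRO := MkIRO (subI_subproof k V).

Definition constI (k : int) : IRO := subI k grepr0.

Lemma subID k l V W : subI k V + subI l W = subI (k + l) (dadd_grepr V W).
Proof. by apply/val_inj; rewrite /= -subROD. Qed.

Lemma val_constI k : (constI k : RO R G) = rclass (triv1 R G) *~ k.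
Proof. by rewrite /= /subRO rclass0 subr0. Qed.

End IRO.

Section PullbackIRO.
Variables (R : realType) (H G : finGroupType) (f : {multiplicative H -> G}).

Lemma pbRO_triv1 : pbRO f (rclass (triv1 R G)) = rclass (triv1 R H).
Proof.
rewrite pbRO_rclass; apply: rclass_rsim; exists 1%:M => [//||h _ /=].
  by rewrite row_free_unit unitmx1.
by rewrite mulmx1.
Qed.

Lemma pbRO_subRO k (V : rrep R G) : pbRO f (subRO k V) = subRO k (pbrep f V).
Proof. by rewrite /subRO raddfB /= raddfMz /= pbRO_triv1 pbRO_rclass. Qed.

Lemma pbI_subproof (m : IRO R G) : pbRO f m \in @in_IRO R H.
Proof.
case: m => m /= /asboolP[k [V ->]]; apply/asboolP.
by exists k, (pbrep f V); rewrite pbRO_subRO.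
Qed.
Definition pbI (m : IRO R G) : IRO R H := MkIRO (pbI_subproof m).

Lemma pbID (m n : IRO R G) : pbI (m + n) = pbI m + pbI n.
Proof. by apply/val_inj; rewrite /= raddfD. Qed.

Lemma pbI0 : pbI 0 = 0 :> IRO R H.
Proof. by apply/val_inj; rewrite /= raddf0. Qed.

Lemma pbI_subI k (V : rrep R G) : pbI (subI k V) = subI k (pbrep f V).
Proof. by apply/val_inj; rewrite /= pbRO_subRO. Qed.

End PullbackIRO.

Section PullbackIROTheory.
Variable R : realType.

Lemma pbI_ext (H G : finGroupType) (f g : {multiplicative H -> G}) :
  f =1 g -> @pbI R H G f =1 pbI g.
Proof. by move=> /pbRO_ext-e m; apply/val_inj; rewrite /= e. Qed.

Lemma pbI_id (G : finGroupType) (m : IRO R G) : pbI idfun m = m.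
Proof. by apply/val_inj; rewrite /= pbRO_id. Qed.

Lemma pbI_comp (K H G : finGroupType) (g : {multiplicative H -> G})
    (f : {multiplicative K -> H}) (m : IRO R G) :
  pbI (g \o f) m = pbI f (pbI g m).
Proof. by apply/val_inj; rewrite /= pbRO_comp. Qed.

End PullbackIROTheory.

Record el2 := El2 {
  el2_gp :> finGroupType;
  el2P : (2.-abelem [set: el2_gp])%g
}.

Lemma el2_intro (gT : finGroupType) :
  (forall x y : gT, commute x y) -> (forall x : gT, x ^+ 2 = 1)%g ->
  (2.-abelem [set: gT])%g.
Proof.
move=> cGG G2; apply/abelemP => //; split; last by move=> x _; apply: G2.
by apply/centsP => x _ y _; apply: cGG.
Qed.

Lemma el2_commute (A : el2) (x y : A) : commute x y.
Proof. by apply: (centsP (abelem_abelian (el2P A))); rewrite inE. Qed.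

Lemma el2_sqr (A : el2) (x : A) : (x ^+ 2 = 1)%g.
Proof. by have /abelemP[//|_ ->] := el2P A; rewrite ?inE. Qed.

(* The trivial group, and C = {1, -1} with [b : bool] standing for (-1) ^+ b. *)
Definition unit_gp : Type := unit.
HB.instance Definition _ := Finite.on unit_gp.
Definition sign_gp : Type := bool.
HB.instance Definition _ := Finite.on sign_gp.

Definition unit_mul (_ _ : unit_gp) : unit_gp := tt.
Lemma unit_mulA : associative unit_mul. Proof. by []. Qed.
Lemma unit_mul1 : left_id (tt : unit_gp) unit_mul. Proof. by case. Qed.
Lemma unit_mulV : left_inverse (tt : unit_gp) id unit_mul. Proof. by []. Qed.
HB.instance Definition _ :=
  Finite_isGroup.Build unit_gp unit_mulA unit_mul1 unit_mulV.

HB.instance Definition _ := Finite_isGroup.Build sign_gp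
  (addbA : associative (addb : sign_gp -> sign_gp -> sign_gp)) addFb addbb.

Lemma unit_gp_abelem : (2.-abelem [set: unit_gp])%g.
Proof. by apply: el2_intro => // -[]. Qed.
Definition el2_1 := El2 unit_gp_abelem.

Lemma sign_gp_abelem : (2.-abelem [set: sign_gp])%g.
Proof. by apply: el2_intro => [|[]] // [] []. Qed.
Definition el2_C := El2 sign_gp_abelem.

Lemma prod_abelem (A B : el2) : (2.-abelem [set: A * B])%g.
Proof.
apply: el2_intro => [[a b] [a' b']|[a b]].
  by congr (_, _); apply: el2_commute.
by congr (_, _); apply: el2_sqr.
Qed.
Definition el2_prod (A B : el2) := El2 (prod_abelem A B).

Lemma subg_abelem (A : el2) (K : {group A}) : (2.-abelem [set: [subg K]])%g.
Proof.
apply: el2_intro => [x y|x]; apply: val_inj; first exact: el2_commute.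
exact: el2_sqr.
Qed.
Definition el2_sub (A : el2) (K : {group A}) := El2 (subg_abelem K).

Section GroupHoms.

Definition sub_incl (A : el2) (K : {group A}) (x : el2_sub K) : A := sgval x.
Lemma sub_incl_mul (A : el2) (K : {group A}) :
  {morph @sub_incl A K : x y / (x * y)%g}.
Proof. by []. Qed.
HB.instance Definition _ (A : el2) (K : {group A}) :=
  isMultiplicative.Build (el2_sub K) A (@sub_incl A K) (@sub_incl_mul A K).

Definition one_hom (A B : el2) (_ : A) : B := 1%g.
Lemma one_hom_mul (A B : el2) : {morph @one_hom A B : x y / (x * y)%g}.
Proof. by move=> x y; rewrite /one_hom mulg1. Qed.
HB.instance Definition _ (A B : el2) :=
  isMultiplicative.Build A B (@one_hom A B) (@one_hom_mul A B).

Definition pair_hom (A B C : el2) (f : {multiplicative A -> B})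
  (g : {multiplicative A -> C}) (x : A) : el2_prod B C := (f x, g x).
Lemma pair_hom_mul (A B C : el2) (f : {multiplicative A -> B})
    (g : {multiplicative A -> C}) : {morph @pair_hom A B C f g : x y / (x * y)%g}.
Proof. by move=> x y; rewrite /pair_hom !gmulfM. Qed.
HB.instance Definition _ (A B C : el2) (f : {multiplicative A -> B})
    (g : {multiplicative A -> C}) :=
  isMultiplicative.Build A (el2_prod B C) (@pair_hom A B C f g)
    (@pair_hom_mul A B C f g).

Definition p1 (A B : el2) : {multiplicative el2_prod A B -> A} := fst.
Definition p2 (A B : el2) : {multiplicative el2_prod A B -> B} := snd.

Definition mul_hom (x : el2_prod el2_C el2_C) : el2_C := (x.1 * x.2)%g.
Lemma mul_hom_mul : {morph mul_hom : x y / (x * y)%g}.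
Proof. by do ![case]. Qed.
HB.instance Definition _ :=
  isMultiplicative.Build (el2_prod el2_C el2_C) el2_C mul_hom mul_hom_mul.

End GroupHoms.

Section Category.
Variable R : realType.

Record el2RO := Ob { ob_gp : el2; ob_deg : IRO R ob_gp }.
Arguments Ob {ob_gp} _.

Record el2hom (Y Z : el2RO) := Hom {
  hom_fun :> {multiplicative ob_gp Y -> ob_gp Z};
  hom_deg : pbI hom_fun (ob_deg Z) = ob_deg Y
}.

Definition hid (Y : el2RO) : el2hom Y Y := Hom (pbI_id (ob_deg Y)).

Lemma hcomp_subproof (Y Z W : el2RO) (g : el2hom Z W) (f : el2hom Y Z) :
  pbI (g \o f) (ob_deg W) = ob_deg Y.
Proof. by rewrite pbI_comp !hom_deg. Qed.
Definition hcomp (Y Z W : el2RO) (g : el2hom Z W) (f : el2hom Y Z) : el2hom Y W :=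
  Hom (hcomp_subproof g f).

Definition tensor (Y Z : el2RO) : el2RO :=
  @Ob (el2_prod (ob_gp Y) (ob_gp Z))
    (pbI (p1 _ _) (ob_deg Y) + pbI (p2 _ _) (ob_deg Z)).

Definition tunit : el2RO := @Ob el2_1 0.

Lemma htensor_subproof (Y Y' Z Z' : el2RO) (f : el2hom Y Y') (g : el2hom Z Z') :
  pbI (pair_hom (f \o p1 _ _) (g \o p2 _ _)) (ob_deg (tensor Y' Z'))
  = ob_deg (tensor Y Z).
Proof.
rewrite /tensor /= pbID -!pbI_comp -(hom_deg f) -(hom_deg g) -!pbI_comp.
by congr (_ + _); apply: pbI_ext.
Qed.
Definition htensor Y Y' Z Z' (f : el2hom Y Y') (g : el2hom Z Z') :
  el2hom (tensor Y Z) (tensor Y' Z') :=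
  @Hom (tensor Y Z) (tensor Y' Z') _ (htensor_subproof f g).

Lemma hassoc_subproof (Y Z W : el2RO) :
  pbI (pair_hom (p1 _ _ \o p1 _ _) (pair_hom (p2 _ _ \o p1 _ _) (p2 _ _)))
    (ob_deg (tensor Y (tensor Z W)))
  = ob_deg (tensor (tensor Y Z) W).
Proof.
rewrite /tensor /= !pbID -!pbI_comp addrA.
by congr (_ + _ + _); apply: pbI_ext.
Qed.
Definition hassoc Y Z W :
    el2hom (tensor (tensor Y Z) W) (tensor Y (tensor Z W)) :=
  @Hom (tensor (tensor Y Z) W) (tensor Y (tensor Z W)) _ (hassoc_subproof Y Z W).

Lemma hunitl_subproof (Y : el2RO) :
  pbI (p2 _ _) (ob_deg Y) = ob_deg (tensor tunit Y).
Proof. by rewrite /tensor /= pbI0 add0r. Qed.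
Definition hunitl Y : el2hom (tensor tunit Y) Y :=
  @Hom (tensor tunit Y) Y _ (hunitl_subproof Y).

Lemma hunitr_subproof (Y : el2RO) :
  pbI (p1 _ _) (ob_deg Y) = ob_deg (tensor Y tunit).
Proof. by rewrite /tensor /= pbI0 addr0. Qed.
Definition hunitr Y : el2hom (tensor Y tunit) Y :=
  @Hom (tensor Y tunit) Y _ (hunitr_subproof Y).

Lemma hswap_subproof (Y Z : el2RO) :
  pbI (pair_hom (p2 _ _) (p1 _ _)) (ob_deg (tensor Z Y))
  = ob_deg (tensor Y Z).
Proof.
rewrite /tensor /= pbID -!pbI_comp addrC.
by congr (_ + _); apply: pbI_ext.
Qed.
Definition hswap Y Z : el2hom (tensor Y Z) (tensor Z Y) :=
  @Hom (tensor Y Z) (tensor Z Y) _ (hswap_subproof Y Z).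

Lemma hdiag_subproof (A : el2) (m n : IRO R A) :
  pbI (pair_hom idfun idfun) (ob_deg (tensor (Ob m) (Ob n))) = m + n.
Proof.
rewrite /tensor /= pbID -!pbI_comp -[in RHS](pbI_id m) -[in RHS](pbI_id n).
by congr (_ + _); apply: pbI_ext.
Qed.
Definition hdiag (A : el2) (m n : IRO R A) :
  el2hom (Ob (m + n)) (tensor (Ob m) (Ob n)) :=
  @Hom (Ob (m + n)) (tensor (Ob m) (Ob n)) _ (hdiag_subproof m n).

(* The identity of [A], as a morphism between propositionally equal objects. *)
Lemma heq_subproof (A : el2) (m n : IRO R A) (e : m = n) : pbI idfun m = n.
Proof. by rewrite pbI_id. Qed.
Definition heq (A : el2) (m n : IRO R A) (e : m = n) : el2hom (Ob n) (Ob m) :=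
  @Hom (Ob n) (Ob m) _ (heq_subproof e).

End Category.

Arguments Ob {R ob_gp} _.
Arguments tunit {R}.

(* A lax symmetric monoidal functor from the opposite of el_2^RO to F_2-vector
   spaces; a linear map out of a tensor product is given as a bilinear map
   [alg_mul], and a linear map out of F_2 as a vector [alg_unit]. *)
Record el2RO_alg (R : realType) := El2ROAlg {
  alg_ob :> el2RO R -> lmodType 'F_2;
  alg_res : forall Y Z, el2hom Y Z -> {linear alg_ob Z -> alg_ob Y};
  alg_mul : forall Y Z, alg_ob Y -> alg_ob Z -> alg_ob (tensor Y Z);
  alg_unit : alg_ob tunit;
  res_id : forall Y x, alg_res (hid Y) x = x;
  res_comp : forall Y Z W (g : el2hom Z W) (f : el2hom Y Z) x,
    alg_res (hcomp g f) x = alg_res f (alg_res g x);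
  mul_linearl : forall Y Z (y : alg_ob Z),
    linear (fun x : alg_ob Y => alg_mul x y);
  mul_linearr : forall Y Z (x : alg_ob Y),
    linear (fun y : alg_ob Z => alg_mul x y);
  mul_res : forall Y Y' Z Z' (f : el2hom Y Y') (g : el2hom Z Z') x y,
    alg_res (htensor f g) (alg_mul x y) = alg_mul (alg_res f x) (alg_res g y);
  mul_assoc : forall Y Z W (x : alg_ob Y) (y : alg_ob Z) (z : alg_ob W),
    alg_res (hassoc Y Z W) (alg_mul x (alg_mul y z)) = alg_mul (alg_mul x y) z;
  mul_unitl : forall Y (x : alg_ob Y), alg_mul alg_unit x = alg_res (hunitl Y) x;
  mul_unitr : forall Y (x : alg_ob Y), alg_mul x alg_unit = alg_res (hunitr Y) x;
  mul_swap : forall Y Z (x : alg_ob Y) (y : alg_ob Z),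
    alg_res (hswap Y Z) (alg_mul y x) = alg_mul x y
}.

Arguments alg_res {R} X {Y Z} : rename.
Arguments alg_mul {R} X {Y Z} : rename.
Arguments alg_unit {R} X : rename.

Record alg_mor (R : realType) (X X' : el2RO_alg R) := AlgMor {
  mor_fun :> forall Y : el2RO R, X Y -> X' Y;
  mor_linear : forall Y, linear (@mor_fun Y);
  mor_res : forall Y Z (f : el2hom Y Z) x,
    @mor_fun Y (alg_res X f x) = alg_res X' f (@mor_fun Z x);
  mor_mul : forall Y Z (x : X Y) (y : X Z),
    @mor_fun _ (alg_mul X x y) = alg_mul X' (@mor_fun Y x) (@mor_fun Z y);
  mor_unit : @mor_fun _ (alg_unit X) = alg_unit X'
}.

Section Products.
Variables (R : realType) (X : el2RO_alg R) (A : el2).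

Definition pmul (m n : IRO R A) (x : X (Ob m)) (y : X (Ob n)) : X (Ob (m + n)) :=
  alg_res X (hdiag m n) (alg_mul X x y).

Definition castX (m n : IRO R A) (e : m = n) (x : X (Ob m)) : X (Ob n) :=
  alg_res X (heq e) x.

End Products.

Notation el2char A := {multiplicative el2_gp A -> el2_gp el2_C}.

Section Characters.
Variable R : realType.

Lemma chrep_subproof (A : el2) (l : el2char A) :
  mx_repr [set: A]%G (fun g => ((-1) ^+ (l g : bool))%:M : 'M[R]_1).
Proof.
split=> [|x y _ _]; first by rewrite ghom1.
by rewrite gmulfM [(l x * l y)%g]/(l x (+) l y) signr_addb scalar_mxM.
Qed.
Definition chrep (A : el2) (l : el2char A) : rrep R A :=
  Representation (MxRepresentation (chrep_subproof l)).

Definition sigma : rrep R el2_C := chrep idfun.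

Lemma hchar_subproof k (A : el2) (l : el2char A) :
  pbI l (subI k sigma) = subI k (chrep l).
Proof.
rewrite pbI_subI; apply/val_inj; rewrite /= /subRO; congr (_ - _).
apply: rclass_rsim; exists 1%:M => [//||h _ /=].
  by rewrite row_free_unit unitmx1.
by rewrite mulmx1 mul1mx.
Qed.
Definition hchar k (A : el2) (l : el2char A) :
    el2hom (Ob (subI k (chrep l))) (Ob (subI k sigma)) :=
  @Hom R (Ob (subI k (chrep l))) (Ob (subI k sigma)) _ (hchar_subproof k l).

Lemma hone_subproof : pbI (@one_hom el2_1 el2_C) (subI 1 sigma) = 0.
Proof.
rewrite pbI_subI; apply/val_inj; rewrite /= /subRO mulr1z.
apply/eqP; rewrite subr_eq0; apply/eqP/rclass_rsim.
exists 1%:M => [//||h _ /=]; first by rewrite row_free_unit unitmx1.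
by rewrite mulmx1 ?mul1mx.
Qed.
Definition hone : el2hom tunit (Ob (subI 1 sigma)) :=
  @Hom R tunit (Ob (subI 1 sigma)) _ hone_subproof.

Definition nontrivial (A : el2) (l : el2char A) := exists g, l g != 1%g.

Lemma kerl_group_set (A : el2) (l : el2char A) : group_set [set g | l g == 1%g].
Proof.
apply/group_setP; split=> [|x y]; rewrite !inE ?ghom1 //.
by rewrite gmulfM => /eqP-> /eqP->; rewrite mulg1.
Qed.
Definition kerl (A : el2) (l : el2char A) : {group A} := Group (kerl_group_set l).

Lemma hker_subproof (A : el2) (l : el2char A) (m : IRO R A) :
  pbI (@sub_incl A (kerl l)) (m + subI 0 (chrep l))
  = pbI (@sub_incl A (kerl l)) m + constI R (el2_sub (kerl l)) (-1).
Proof.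
rewrite pbID; congr (_ + _); rewrite pbI_subI; apply/val_inj.
rewrite /= /subRO rclass0 mulr0z sub0r subr0 mulrNz mulr1z; congr (- _).
apply: rclass_rsim; exists 1%:M => [//||h _ /=].
  by rewrite row_free_unit unitmx1.
have := valP h; rewrite inE => /eqP lh.
by rewrite [l _]lh mulmx1.
Qed.
Definition hker (A : el2) (l : el2char A) (m : IRO R A) :
    el2hom (Ob (pbI (@sub_incl A (kerl l)) m + constI R (el2_sub (kerl l)) (-1)))
        (Ob (m + subI 0 (chrep l))) :=
  @Hom R (Ob _) (Ob _) _ (hker_subproof l m).

End Characters.

Section Orientable.
Variables (R : realType) (X : el2RO_alg R).

(* The degree -lambda. *)
Notation neg l := (subI 0 (chrep R l)).

Definition euler (a : X (Ob (subI 0 (sigma R)))) (A : el2) (l : el2char A) :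
    X (Ob (neg l)) := alg_res X (hchar R 0 l) a.

Definition thom (t : X (Ob (subI 1 (sigma R)))) (A : el2) (l : el2char A) :
    X (Ob (subI 1 (chrep R l))) := alg_res X (hchar R 1 l) t.

Definition euler_mul (a : X (Ob (subI 0 (sigma R)))) (A : el2) (l : el2char A)
    (m : IRO R A) (x : X (Ob m)) : X (Ob (m + neg l)) :=
  castX (addrC (neg l) m) (pmul (euler a l) x).

Definition is_orientation (a : X (Ob (subI 0 (sigma R)))) : Prop :=
  forall (A : el2) (m : IRO R A) (l : el2char A), nontrivial l ->
    [/\ injective (@euler_mul a A l m),
        forall y : X (Ob (m + neg l)),
          alg_res X (hker l m) y = 0 <-> exists x, euler_mul a l x = y
      & forall z, exists y, alg_res X (hker l m) y = z].

Definition inverse_thom (t : X (Ob (subI 1 (sigma R)))) : Prop :=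
  alg_res X (hone R) t = alg_unit X.

Lemma subI3 (A : el2) (U V W : rrep R A) (k1 k2 k3 k : int) :
  k1 + k2 + k3 = k ->
  subI k1 U + subI k2 V + subI k3 W = subI k (dadd_grepr (dadd_grepr U V) W).
Proof. by move=> <-; rewrite !subID. Qed.

Definition pmul3 (A : el2) (U V W : rrep R A) (k1 k2 k3 k : int)
    (e : k1 + k2 + k3 = k)
    (x : X (Ob (subI k1 U))) (y : X (Ob (subI k2 V))) (z : X (Ob (subI k3 W))) :
    X (Ob (subI k (dadd_grepr (dadd_grepr U V) W))) :=
  castX (subI3 U V W e) (pmul (pmul x y) z).

Definition is_additive (a : X (Ob (subI 0 (sigma R))))
    (t : X (Ob (subI 1 (sigma R)))) : Prop :=
  let a1 := euler a (p1 el2_C el2_C) in let t1 := thom t (p1 el2_C el2_C) in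
  let am := euler a mul_hom in let tm := thom t mul_hom in
  let a2 := euler a (p2 el2_C el2_C) in let t2 := thom t (p2 el2_C el2_C) in
  @pmul3 _ _ _ _ 0 1 1 2 erefl a1 tm t2 + @pmul3 _ _ _ _ 1 0 1 2 erefl t1 am t2
    + @pmul3 _ _ _ _ 1 1 0 2 erefl t1 tm a2 = 0.

Definition is_bredon : Prop :=
  forall A : el2,
    (exists f : {linear X (Ob (constI R A 0)) -> ('F_2)^o}, bijective f) /\
    (forall k : int, k != 0 -> forall x : X (Ob (constI R A k)), x = 0).

End Orientable.

Record orientable_alg (R : realType) := OrientableAlg {
  ori_alg :> el2RO_alg R;
  pre_euler : ori_alg (Ob (subI 0 (sigma R)));
  pre_eulerP : is_orientation pre_euler
}.

Record orientable_mor (R : realType) (X X' : orientable_alg R) := OrientableMor {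
  ori_mor :> alg_mor X X';
  mor_pre_euler : ori_mor _ (pre_euler X) = pre_euler X'
}.

Definition is_iso (R : realType) (X X' : orientable_alg R)
    (f : orientable_mor X X') : Prop :=
  exists g : orientable_mor X' X,
    forall Y : el2RO R, cancel (f Y) (g Y) /\ cancel (g Y) (f Y).

(* Main.v *)
(* Every degree of A is k - V with V a sum of characters, and by exactness every
   class of H(A, k - V) is a polynomial in the classes a_l, t_l for l in V: its
   restriction to ker l lifts, after multiplication by t_l, up to a multiple of
   a_l. So a morphism is determined by the image of t, and it exists as soon as
   every polynomial that vanishes in H vanishes in X. For this, consider the
   polynomials in the pairs (a_l, a_l), (t_l, t_l) of H x X. Since the a_l are
   regular, such a polynomial may be multiplied by them freely, and additivity,
   in the form t_l a_n t_ln = t_l a_ln t_n + a_l t_n t_ln, then serves as a partial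
   fraction decomposition. This reduces the claim to proper subgroups. *)

Require Import Defs.
From HB Require Import structures.
From mathcomp Require Import all_boot all_algebra.
From mathcomp Require Import fingroup mxrepresentation character.
From mathcomp Require Import boolp reals ring.
From mathcomp.multinomials Require Import freeg.
From mathcomp Require Import generic_quotient.

Set Implicit Arguments.
Unset Strict Implicit.
Unset Printing Implicit Defensive.

Import GRing.Theory Num.Theory.

Local Open Scope ring_scope.

(** * Direct sums *)

(** The obstacle is to stay inside the polynomials. If [e_l * b + t_l * c] is null, [c] vanishes on
    [ker l] by induction, and exactness makes [c] a multiple [e_l * c']; but [c'] need not be a
    polynomial, so the induction could not go on with [b + t_l * c']. The partial fractions make the
    quotient by [e_l] an explicit polynomial, at the price of Euler classes of characters trivial at
    a chosen [g] outside [ker l]. These do not affect the inner induction, which counts the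
    characters nontrivial at [g]. The Bredon condition enters in constant degrees only: it starts
    the proof that polynomials generate, shows that 1 is not 0, and forces the inverse Thom class of
    [H] to be unique and additive. Equal degrees are often equal only propositionally, so the
    components over one group are collected in a single ring. Moreover a degree is [k - V] in
    several ways, since trivial characters can be traded against [k]; orthogonality of characters
    shows that the span of polynomials depends on the degree alone. *)

Section DirectSum.
Variables (I : Type) (M : I -> zmodType).

Notation homog := {i : I & M i}.

Definition gcoef (e : homog) (j : I) : M j :=
  if pselect (projT1 e = j) is left E
  then eq_rect _ (fun i => M i : Type) (projT2 e) _ E else 0.

Lemma gcoef_id i (x : M i) : gcoef (existT _ i x) i = x.
Proof.
by rewrite /gcoef; case: pselect => //= E; rewrite (Prop_irrelevance E erefl).
Qed.

Lemma gcoef_neq (e : homog) j : projT1 e <> j -> gcoef e j = 0.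
Proof. by rewrite /gcoef; case: pselect. Qed.

Lemma gcoefD i (x y : M i) j :
  gcoef (existT _ i (x + y)) j = gcoef (existT _ i x) j + gcoef (existT _ i y) j.
Proof.
have [<-|ne] := pselect (i = j); first by rewrite !gcoef_id.
by rewrite !gcoef_neq //= addr0.
Qed.

Definition gopp (e : homog) : homog := existT _ (projT1 e) (- projT2 e).

Lemma gcoefN (e : homog) j : gcoef (gopp e) j = - gcoef e j.
Proof.
case: e => i x; have [<-|ne] := pselect (i = j); first by rewrite !gcoef_id.
by rewrite !gcoef_neq //= oppr0.
Qed.

(** The list of terms is only asserted to exist, so that elements with the same components are
    equal, and finiteness of the support is expressed without deciding equality on [I]. *)
Record dsum := DSum {
  dfun :> forall i, M i;
  dfunP : exists l : seq homog, forall i, dfun i = \sum_(e <- l) gcoef e i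
}.

Lemma dsum_eq (z w : dsum) : (forall i, z i = w i) -> z = w.
Proof.
case: z w => [z zP] [w wP] /= eq_zw'.
have eq_zw := functional_extensionality_dep eq_zw'; subst w.
by rewrite (Prop_irrelevance zP wP).
Qed.

HB.instance Definition _ := gen_eqMixin dsum.
HB.instance Definition _ := gen_choiceMixin dsum.

Definition dsum_of (l : seq homog) : dsum :=
  @DSum (fun i => \sum_(e <- l) gcoef e i) (ex_intro _ l (fun=> erefl)).

Definition drep (z : dsum) : seq homog := projT1 (cid (dfunP z)).

Lemma drepP (z : dsum) i : z i = \sum_(e <- drep z) gcoef e i.
Proof. by rewrite /drep; case: cid. Qed.

Definition dzero := dsum_of [::].
Definition dadd (z w : dsum) := dsum_of (drep z ++ drep w).
Definition dopp (z : dsum) := dsum_of (map gopp (drep z)).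

Lemma daddE z w i : dadd z w i = z i + w i.
Proof. by rewrite /dadd /= big_cat -!drepP. Qed.

Lemma doppE z i : dopp z i = - z i.
Proof.
by rewrite /= big_map (drepP z) -sumrN; apply: eq_bigr => e _; apply: gcoefN.
Qed.

Lemma dzeroE i : dzero i = 0. Proof. exact: big_nil. Qed.

Lemma daddA : associative dadd.
Proof. by move=> x y z; apply: dsum_eq => i; rewrite !daddE addrA. Qed.
Lemma daddC : commutative dadd.
Proof. by move=> x y; apply: dsum_eq => i; rewrite !daddE addrC. Qed.
Lemma dadd0 : left_id dzero dadd.
Proof. by move=> x; apply: dsum_eq => i; rewrite daddE dzeroE add0r. Qed.
Lemma daddN : left_inverse dzero dopp dadd.
Proof. by move=> x; apply: dsum_eq => i; rewrite daddE doppE dzeroE addNr. Qed.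

HB.instance Definition _ := GRing.isZmodule.Build dsum daddA daddC dadd0 daddN.

Lemma dsumD (z w : dsum) i : (z + w) i = z i + w i.
Proof. exact: daddE. Qed.
Lemma dsum0 i : (0 : dsum) i = 0.
Proof. exact: dzeroE. Qed.

Definition din i (x : M i) : dsum := dsum_of [:: existT _ i x].

Lemma dinE i (x : M i) j : din x j = gcoef (existT _ i x) j.
Proof. exact: big_seq1. Qed.

Lemma din_id i (x : M i) : din x i = x.
Proof. by rewrite dinE gcoef_id. Qed.

Lemma din_inj i : injective (@din i).
Proof. by move=> x y eq_xy; rewrite -(din_id x) eq_xy din_id. Qed.

Lemma dinD i : {morph @din i : x y / x + y}.
Proof. by move=> x y; apply: dsum_eq => j; rewrite dsumD !dinE gcoefD. Qed.

Lemma din0 i : din (0 : M i) = 0.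
Proof. by apply: (addrI (din (0 : M i))); rewrite -dinD !addr0. Qed.

Lemma dsum_ofE l : dsum_of l = \sum_(e <- l) din (projT2 e).
Proof.
apply: dsum_eq => i; elim: l => [|[j x] l IH] /=.
  by rewrite !big_nil dsum0.
by rewrite !big_cons dsumD dinE -IH.
Qed.

Lemma drepE z : z = \sum_(e <- drep z) din (projT2 e).
Proof. by rewrite -dsum_ofE; apply: dsum_eq => i; rewrite drepP. Qed.

Lemma dsum_ind (P : dsum -> Prop) :
  P 0 -> (forall z w, P z -> P w -> P (z + w)) -> (forall i x, P (@din i x)) ->
  forall z, P z.
Proof. by move=> P0 PD Pin z; rewrite (drepE z); apply: big_ind. Qed.

Section Lift.
Variables (Z : zmodType) (F : forall i, M i -> Z).
Hypothesis FD : forall i, {morph @F i : x y / x + y}.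

Let F0 i : F (0 : M i) = 0.
Proof. by apply: (addrI (F (0 : M i))); rewrite -FD !addr0. Qed.

Let FN i (x : M i) : F (- x) = - F x.
Proof. by apply/eqP; rewrite -subr_eq0 opprK -FD addNr F0. Qed.

Definition dlift (z : dsum) : Z := \sum_(e <- drep z) F (projT2 e).

(** This makes [dlift] independent of the list picked by [drep]. The terms with the index of the
    head sum to [F] of a zero coefficient; removing them keeps all coefficients zero and shortens
    the list. *)
Lemma sum_homog_eq0 (l : seq homog) :
  (forall i, \sum_(e <- l) gcoef e i = 0) -> \sum_(e <- l) F (projT2 e) = 0.
Proof.
have [n] := ubnP (size l); elim: n => // n IHn in l *.
case: l => [|[j y] l] lt_ln l0; first by rewrite big_nil.
pose same := [pred e : homog | `[< projT1 e = j >]].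
have same_sum: \sum_(e <- existT _ j y :: l | same e) F (projT2 e) = 0.
  transitivity (F (\sum_(e <- existT _ j y :: l) gcoef e j)); last first.
    by rewrite l0 F0.
  elim: (existT _ j y :: l) => [|[i x] s IHs]; first by rewrite !big_nil F0.
  rewrite !big_cons FD -IHs /=; case: asboolP => [/= eij|ne].
    by congr (_ + _); rewrite -eij gcoef_id.
  by rewrite gcoef_neq // F0 add0r.
rewrite (bigID same) /= same_sum add0r big_cons /= asboolT //= -big_filter.
apply: IHn => [|i].
  by rewrite size_filter (leq_ltn_trans (count_size _ _)) ?lt_ln.
rewrite big_filter; have [<-|ne_ji] := pselect (j = i).
  rewrite big1 // => e /asboolPn ne.
  by rewrite gcoef_neq // => /esym ej; apply: ne; rewrite ej.
rewrite -[RHS](l0 i) big_cons gcoef_neq //= add0r big_mkcond /=.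
apply: eq_bigr => e _; case: asboolP => //= eej.
by rewrite gcoef_neq // eej.
Qed.

Lemma dlift_sum (z : dsum) (l : seq homog) :
  (forall i, z i = \sum_(e <- l) gcoef e i) ->
  dlift z = \sum_(e <- l) F (projT2 e).
Proof.
move=> zl; apply/eqP; rewrite -subr_eq0 /dlift.
rewrite -sumrN; under [in X in _ + X]eq_bigr do rewrite -FN.
rewrite -(big_map gopp xpredT (fun e => F (projT2 e))) -big_cat.
apply/eqP/sum_homog_eq0 => i; rewrite big_cat -drepP zl big_map /=.
by rewrite (eq_bigr _ (fun e _ => gcoefN e i)) sumrN subrr.
Qed.

Lemma dlift_din i (x : M i) : dlift (din x) = F x.
Proof. by rewrite (@dlift_sum _ [:: existT _ i x]) ?big_seq1. Qed.

Lemma dliftD : {morph dlift : z w / z + w}.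
Proof.
move=> z w; rewrite (@dlift_sum _ (drep z ++ drep w)); first by rewrite big_cat.
by move=> i; rewrite dsumD !drepP big_cat.
Qed.

End Lift.

Lemma dliftDF (Z : zmodType) (F G : forall i, M i -> Z) z :
  dlift (fun i x => F i x + G i x) z = dlift F z + dlift G z.
Proof. exact: big_split. Qed.

Lemma eq_dlift (Z : zmodType) (F G : forall i, M i -> Z) z :
  (forall i x, F i x = G i x) -> dlift F z = dlift G z.
Proof. by move=> eqFG; apply: eq_bigr. Qed.

End DirectSum.

(** * The total ring of an algebra *)

Lemma multiplicative_eq (G H : baseGroupType) (f g : {multiplicative G -> H}) :
  f =1 g -> f = g.
Proof.
move=> eq_fg; have {eq_fg} := functional_extensionality_dep eq_fg.
case: f g => [f [[fP]]] [g [[gP]]] /= eq_fg; subst g.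
by rewrite (Prop_irrelevance fP gP).
Qed.

Lemma el2hom_eq (R : realType) (Y Z : el2RO R) (f g : el2hom Y Z) :
  hom_fun f =1 hom_fun g -> f = g.
Proof.
case: f g => [f fP] [g gP] /= /multiplicative_eq eq_fg; subst g.
by rewrite (Prop_irrelevance fP gP).
Qed.

Section TotalRing.
Variables (R : realType) (X : el2RO_alg R).

(* The direct sum of all [X (A, m)], where equalities of degrees need no casts. *)
Definition total (A : el2) := dsum (fun m : IRO R A => X (Ob m) : zmodType).
HB.instance Definition _ (A : el2) := GRing.Zmodule.on (total A).

Definition tin (A : el2) (m : IRO R A) (x : X (Ob m)) : total A :=
  din (M := fun m : IRO R A => X (Ob m) : zmodType) x.

Lemma tin_inj (A : el2) (m : IRO R A) : injective (@tin A m).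
Proof. exact: din_inj. Qed.

Lemma tinD (A : el2) (m : IRO R A) : {morph @tin A m : x y / x + y}.
Proof. exact: dinD. Qed.

Lemma tin0 (A : el2) (m : IRO R A) : tin (0 : X (Ob m)) = 0.
Proof. exact: din0. Qed.

Lemma total_ind (A : el2) (P : total A -> Prop) :
  P 0 -> (forall z w, P z -> P w -> P (z + w)) -> (forall m x, P (@tin A m x)) ->
  forall z, P z.
Proof. exact: dsum_ind. Qed.

(** The homomorphism and the target determine the source degree, so [m = n] is forced by [hom_deg].
    Coherence maps that are the identity on groups thus become equalities in the total ring. *)
Lemma tin_res (A : el2) (m n : IRO R A) (Z : el2RO R) (f : el2hom (Ob m) Z)
    (g : el2hom (Ob n) Z) (x : X Z) :
  hom_fun f =1 hom_fun g -> tin (alg_res X f x) = tin (alg_res X g x).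
Proof.
move=> eq_fg; have emn : m = n.
  exact: etrans (esym (hom_deg f)) (etrans (pbI_ext eq_fg _) (hom_deg g)).
by subst n; rewrite (el2hom_eq eq_fg).
Qed.

Lemma tin_res_id (A : el2) (m n : IRO R A) (f : el2hom (Ob n) (Ob m))
    (x : X (Ob m)) :
  hom_fun f =1 id -> tin (alg_res X f x) = tin x.
Proof. by move=> f1; rewrite -[in RHS](res_id x); apply: tin_res. Qed.

Lemma tin_cast (A : el2) (m n : IRO R A) (e : m = n) (x : X (Ob m)) :
  tin (castX e x) = tin x.
Proof. exact: tin_res_id. Qed.

Lemma alg_mulDl Y Z (y : X Z) :
  {morph (fun x : X Y => alg_mul X x y) : x x' / x + x'}.
Proof. by move=> x x'; rewrite -[in LHS](scale1r x) mul_linearl scale1r. Qed.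

Lemma alg_mulDr Y Z (x : X Y) :
  {morph (fun y : X Z => alg_mul X x y) : y y' / y + y'}.
Proof. by move=> y y'; rewrite -[in LHS](scale1r y) mul_linearr scale1r. Qed.

Lemma pmulDl (A : el2) (m n : IRO R A) (x x' : X (Ob m)) (y : X (Ob n)) :
  pmul (x + x') y = pmul x y + pmul x' y.
Proof. by rewrite /pmul alg_mulDl raddfD. Qed.

Lemma pmulDr (A : el2) (m n : IRO R A) (x : X (Ob m)) (y y' : X (Ob n)) :
  pmul x (y + y') = pmul x y + pmul x y'.
Proof. by rewrite /pmul alg_mulDr raddfD. Qed.

Lemma tin_pmulA (A : el2) (m n p : IRO R A) (x : X (Ob m)) (y : X (Ob n))
    (z : X (Ob p)) :
  tin (pmul x (pmul y z)) = tin (pmul (pmul x y) z).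
Proof.
rewrite /pmul -[X in alg_mul _ X (alg_res _ _ _)]res_id -mul_res -res_comp.
rewrite -[X in alg_mul _ (alg_res _ _ _) X]res_id -mul_res -res_comp.
by rewrite -mul_assoc -res_comp; apply: tin_res.
Qed.

Lemma tin_pmulC (A : el2) (m n : IRO R A) (x : X (Ob m)) (y : X (Ob n)) :
  tin (pmul x y) = tin (pmul y x).
Proof. by rewrite /pmul -mul_swap -res_comp; apply: tin_res. Qed.

Definition hbang (A : el2) : el2hom (Ob 0) (@tunit R) :=
  @Defs.Hom R (Ob 0) (@tunit R) (@one_hom A el2_1) (pbI0 _ _).

Lemma tin_pmul1 (A : el2) (m : IRO R A) (x : X (Ob m)) :
  tin (pmul (alg_res X (hbang A) (alg_unit X)) x) = tin x.
Proof.
rewrite /pmul -[X in alg_mul _ (alg_res _ _ _) X]res_id -mul_res -res_comp.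
by rewrite mul_unitl -res_comp; apply: tin_res_id.
Qed.

Definition tmul (A : el2) (z w : total A) : total A :=
  dlift (fun m x => dlift (fun n y => tin (pmul x y)) w) z.
Definition tone (A : el2) : total A := tin (alg_res X (hbang A) (alg_unit X)).

Lemma tmul_inD (A : el2) (m n : IRO R A) (x : X (Ob m)) :
  {morph (fun y : X (Ob n) => tin (pmul x y)) : y y' / y + y'}.
Proof. by move=> y y'; rewrite pmulDr tinD. Qed.

Lemma tmul_in (A : el2) (m : IRO R A) (x : X (Ob m)) (w : total A) :
  tmul (tin x) w = dlift (fun n y => tin (pmul x y)) w.
Proof.
rewrite /tmul dlift_din // => k {}x x'; rewrite -dliftDF.
by apply: eq_dlift => n y; rewrite pmulDl tinD.
Qed.

Lemma tmul_tin (A : el2) (m n : IRO R A) (x : X (Ob m)) (y : X (Ob n)) :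
  tmul (tin x) (tin y) = tin (pmul x y).
Proof. by rewrite tmul_in dlift_din // => k; apply: tmul_inD. Qed.

Lemma tmulDl (A : el2) : left_distributive (@tmul A) +%R.
Proof.
move=> z z' w; rewrite /tmul dliftD // => m x x'; rewrite -dliftDF.
by apply: eq_dlift => n y; rewrite pmulDl tinD.
Qed.

Lemma tmulDr (A : el2) : right_distributive (@tmul A) +%R.
Proof.
move=> z w w'; rewrite -dliftDF; apply: eq_dlift => m x.
by rewrite dliftD // => n; apply: tmul_inD.
Qed.

Lemma tmul0z (A : el2) (z : total A) : tmul 0 z = 0.
Proof. by apply: (addrI (tmul 0 z)); rewrite -tmulDl !addr0. Qed.

Lemma tmulz0 (A : el2) (z : total A) : tmul z 0 = 0.
Proof. by apply: (addrI (tmul z 0)); rewrite -tmulDr !addr0. Qed.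

Lemma tmulC (A : el2) : commutative (@tmul A).
Proof.
move=> z w; elim/total_ind: z => [|z z' IH IH'|m x].
- by rewrite tmul0z tmulz0.
- by rewrite tmulDl tmulDr IH IH'.
elim/total_ind: w => [|w w' IH IH'|n y].
- by rewrite tmul0z tmulz0.
- by rewrite tmulDl tmulDr IH IH'.
by rewrite !tmul_tin tin_pmulC.
Qed.

Lemma tmulA (A : el2) : associative (@tmul A).
Proof.
move=> z w v; elim/total_ind: z => [|z z' IH IH'|m x]; first by rewrite !tmul0z.
  by rewrite !tmulDl IH IH'.
elim/total_ind: w => [|w w' IH IH'|n y]; first by rewrite tmulz0 !tmul0z tmulz0.
  by rewrite tmulDr !tmulDl tmulDr IH IH'.
elim/total_ind: v => [|v v' IH IH'|p t]; first by rewrite !tmulz0.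
  by rewrite !tmulDr IH IH'.
by rewrite !tmul_tin tin_pmulA.
Qed.

Lemma tmul1 (A : el2) : left_id (tone A) (@tmul A).
Proof.
elim/total_ind=> [|z w IH IH'|m x]; first exact: tmulz0.
  by rewrite tmulDr IH IH'.
by rewrite tmul_tin tin_pmul1.
Qed.

HB.instance Definition _ (A : el2) := GRing.Zmodule_isComPzRing.Build (total A)
  (@tmulA A) (@tmulC A) (@tmul1 A) (@tmulDl A).

Lemma tin_pmul (A : el2) (m n : IRO R A) (x : X (Ob m)) (y : X (Ob n)) :
  tin (pmul x y) = tin x * tin y.
Proof. by rewrite -tmul_tin. Qed.

Lemma alg_char2 Y (x : X Y) : x + x = 0.
Proof.
rewrite -[x]scale1r -scalerDl; have -> : 1 + 1 = 0 :> 'F_2 by exact/val_inj.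
exact: scale0r.
Qed.

Lemma total_char2 (A : el2) (z : total A) : z + z = 0.
Proof.
elim/total_ind: z => [|z w IH IH'|m x]; first exact: addr0.
  by rewrite addrACA IH IH' addr0.
by rewrite -tinD alg_char2 tin0.
Qed.

Section Pullback.
Variables (B A : el2) (f : {multiplicative B -> A}).

Definition hpb (m : IRO R A) : el2hom (Ob (pbI f m)) (Ob m) :=
  @Defs.Hom R (Ob (pbI f m)) (Ob m) f erefl.

Definition pb (z : total A) : total B :=
  dlift (fun m x => tin (alg_res X (hpb m) x)) z.

Lemma pbD : {morph pb : z w / z + w}.
Proof. by apply: dliftD => m x y; rewrite raddfD tinD. Qed.

Lemma pb0 : pb 0 = 0.
Proof. by apply: (addrI (pb 0)); rewrite -pbD !addr0. Qed.

Lemma pb_hpb (m : IRO R A) (x : X (Ob m)) :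
  pb (tin x) = tin (alg_res X (hpb m) x).
Proof. by apply: dlift_din => n y y'; rewrite raddfD tinD. Qed.

Lemma pb_tin (m : IRO R A) (n : IRO R B) (g : el2hom (Ob n) (Ob m))
    (x : X (Ob m)) :
  hom_fun g =1 f -> pb (tin x) = tin (alg_res X g x).
Proof. by move=> gf; rewrite pb_hpb; apply: tin_res. Qed.

Lemma pb1 : pb 1 = 1.
Proof. by rewrite [LHS]pb_hpb -res_comp; apply: tin_res. Qed.

Lemma pbM : {morph pb : z w / z * w}.
Proof.
move=> z w; elim/total_ind: z => [|z z' IH IH'|m x].
- by rewrite mul0r pb0 mul0r.
- by rewrite mulrDl !pbD IH IH' mulrDl.
elim/total_ind: w => [|w w' IH IH'|n y].
- by rewrite mulr0 pb0 mulr0.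
- by rewrite mulrDr !pbD IH IH' mulrDr.
rewrite -tin_pmul !pb_hpb -tin_pmul /pmul -mul_res -!res_comp.
exact: tin_res.
Qed.

End Pullback.

Lemma pb_ext (B A : el2) (f g : {multiplicative B -> A}) :
  f =1 g -> pb f =1 pb g.
Proof. by move=> /multiplicative_eq->. Qed.

Lemma pb_id (A : el2) : pb (idfun : {multiplicative A -> A}) =1 id.
Proof.
elim/total_ind=> [|z w IH IH'|m x]; first exact: pb0.
  by rewrite pbD IH IH'.
by rewrite pb_hpb; apply: tin_res_id.
Qed.

Lemma pb_comp (D B A : el2) (g : {multiplicative B -> A})
    (f : {multiplicative D -> B}) :
  pb (g \o f) =1 pb f \o pb g.
Proof.
elim/total_ind=> [|z w IH IH'|m x] /=; first by rewrite !pb0.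
  by rewrite !pbD IH IH'.
by rewrite !pb_hpb -res_comp; apply: tin_res.
Qed.

(** The diagonal of [A * B] followed by the product of the two projections is the identity, so the
    external product is recovered from the ring structure and pullbacks. *)
Lemma tin_alg_mul (A B : el2) (m : IRO R A) (n : IRO R B) (x : X (Ob m))
    (y : X (Ob n)) :
  @tin (el2_prod A B) _ (alg_mul X x y) =
  pb (p1 A B) (tin x) * pb (p2 A B) (tin y).
Proof.
rewrite !pb_hpb -tin_pmul /pmul -mul_res -!res_comp.
rewrite -[in LHS](res_id (alg_mul X x y)).
apply: (@tin_res (el2_prod A B)) => -[a b] //.
Qed.

End TotalRing.

(** * Polynomials in Euler and Thom classes *)

(* What is used of the rings [total X A], for [X] oriented and additive: it also
   holds for the products [total H A * total X A], so that graphs of morphisms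
   can be handled like elements. *)
Record ring_family := RingFamily {
  rf_ring :> el2 -> comPzRingType;
  rpb : forall B A : el2, {multiplicative B -> A} -> rf_ring A -> rf_ring B;
  rpbD : forall (B A : el2) (f : {multiplicative B -> A}),
    {morph rpb f : z w / z + w};
  rpbM : forall (B A : el2) (f : {multiplicative B -> A}),
    {morph rpb f : z w / z * w};
  rpb1 : forall (B A : el2) (f : {multiplicative B -> A}), rpb f 1 = 1;
  rpb_id : forall A : el2, rpb (idfun : {multiplicative A -> A}) =1 id;
  rpb_comp : forall (D B A : el2) (g : {multiplicative B -> A})
    (f : {multiplicative D -> B}) (z : rf_ring A),
    rpb (g \o f) z = rpb f (rpb g z);
  rf_char2 : forall (A : el2) (z : rf_ring A), z + z = 0;
  rE : rf_ring el2_C;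
  rT : rf_ring el2_C;
  rE1 : rpb (@one_hom el2_1 el2_C) rE = 0;
  rT1 : rpb (@one_hom el2_1 el2_C) rT = 1;
  rET_mul :
    rpb (p1 el2_C el2_C) rE * rpb mul_hom rT * rpb (p2 el2_C el2_C) rT
    + rpb (p1 el2_C el2_C) rT * rpb mul_hom rE * rpb (p2 el2_C el2_C) rT
    + rpb (p1 el2_C el2_C) rT * rpb mul_hom rT * rpb (p2 el2_C el2_C) rE = 0;
  rE_reg : forall (A : el2) (l : el2char A), nontrivial l ->
    forall z : rf_ring A, rpb l rE * z = 0 -> z = 0
}.

Definition chpb (B A : el2) (f : {multiplicative B -> A}) (l : el2char A) :
  el2char B := l \o f.

Lemma trivial_char (A : el2) (l : el2char A) : ~ nontrivial l ->
  l = chpb (@one_hom A el2_1) (@one_hom el2_1 el2_C).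
Proof.
move=> triv_l; apply: multiplicative_eq => x; apply/eqP.
by apply: contra_notT triv_l => lx; exists x.
Qed.

Section FamilyTheory.
Variable F : ring_family.

Definition fam_euler (A : el2) (l : el2char A) : F A := rpb l (rE F).
Definition fam_thom (A : el2) (l : el2char A) : F A := rpb l (rT F).
Local Notation e_ l := (fam_euler l).
Local Notation t_ l := (fam_thom l).

Lemma rpb0 (B A : el2) (f : {multiplicative B -> A}) : rpb f (0 : F A) = 0.
Proof. by apply: (addrI (rpb f 0)); rewrite -rpbD !addr0. Qed.

Lemma rpb_ext (B A : el2) (f g : {multiplicative B -> A}) (z : F A) :
  f =1 g -> rpb f z = rpb g z.
Proof. by move=> /multiplicative_eq->. Qed.

Lemma rpb_euler (B A : el2) (f : {multiplicative B -> A}) (l : el2char A) :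
  rpb f (e_ l) = e_ (chpb f l).
Proof. by rewrite [RHS]rpb_comp. Qed.

Lemma rpb_thom (B A : el2) (f : {multiplicative B -> A}) (l : el2char A) :
  rpb f (t_ l) = t_ (chpb f l).
Proof. by rewrite [RHS]rpb_comp. Qed.

Lemma fam_euler_trivial (A : el2) (l : el2char A) : ~ nontrivial l -> e_ l = 0.
Proof. by move/trivial_char->; rewrite -rpb_euler [X in rpb _ X]rE1 rpb0. Qed.

Lemma fam_thom_trivial (A : el2) (l : el2char A) : ~ nontrivial l -> t_ l = 1.
Proof. by move/trivial_char->; rewrite -rpb_thom [X in rpb _ X]rT1 rpb1. Qed.

(** The universal relation over [C * C], pulled back along the pair [(l, n)]. *)
Lemma euler_thom_rel (A : el2) (l m n : el2char A) :
  (forall x, m x = (l x * n x)%g) ->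
  e_ l * t_ m * t_ n + t_ l * e_ m * t_ n + t_ l * t_ m * e_ n = 0.
Proof.
move=> lmn; have := congr1 (rpb (pair_hom l n)) (rET_mul F).
rewrite !rpbD !rpbM rpb0 -!rpb_comp.
have pb_l (z : F el2_C) : rpb (p1 _ _ \o pair_hom l n) z = rpb l z.
  exact: rpb_ext.
have pb_n (z : F el2_C) : rpb (p2 _ _ \o pair_hom l n) z = rpb n z.
  exact: rpb_ext.
have pb_m (z : F el2_C) : rpb (mul_hom \o pair_hom l n) z = rpb m z.
  by apply: rpb_ext => x; rewrite lmn.
by rewrite !pb_l !pb_m !pb_n.
Qed.

(* The span of the products over [s] with one factor [e_ l] or [t_ l] for each
   [l] in [s], the factor [t_ l] being chosen [k] times. *)
Inductive etspan (A : el2) : seq (el2char A) -> int -> F A -> Prop :=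
| ETnil0 k : etspan [::] k 0
| ETnil1 : etspan [::] 0 1
| ETcons l s k z w : etspan s k z -> etspan s (k - 1) w ->
    etspan (l :: s) k (e_ l * z + t_ l * w).

Section OneGroup.
Variable A : el2.
Implicit Types (l : el2char A) (s u : seq (el2char A)) (k : int) (z w : F A).

Lemma etspan_consP l s k z : etspan (l :: s) k z ->
  exists b c, [/\ etspan s k b, etspan s (k - 1) c & z = e_ l * b + t_ l * c].
Proof.
move E: (l :: s) => s' Gz; case: Gz E => // l' s1 k' b c Gb Gc [-> ->].
by exists b, c.
Qed.

Lemma etspan_nilP k z : etspan [::] k z -> z = 0 \/ k = 0 /\ z = 1.
Proof. by move E: [::] => s' Gz; case: Gz E => [k'|//|//]; [left|right]. Qed.

Lemma etspan0 s k : etspan s k 0.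
Proof.
elim: s k => [|l s IHs] k; first exact: ETnil0.
have -> : 0 = e_ l * 0 + t_ l * 0 by rewrite !mulr0 addr0.
exact: ETcons.
Qed.

Lemma etspanD s k z w : etspan s k z -> etspan s k w -> etspan s k (z + w).
Proof.
move=> Gz; elim: Gz w => {s k z} [k w||l s k z z' _ IH _ IH' w].
- by rewrite add0r.
- by move=> w /etspan_nilP[->|[_ ->]]; rewrite ?addr0 ?rf_char2; constructor.
case/etspan_consP=> b [c [Gb Gc ->]].
by rewrite addrACA -!mulrDr; apply: ETcons; [apply: IH|apply: IH'].
Qed.

Lemma etspan_e l s k z : etspan s k z -> etspan (l :: s) k (e_ l * z).
Proof.
move=> Gz; rewrite -[_ * z]addr0 -(mulr0 (t_ l)).
by apply: ETcons => //; apply: etspan0.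
Qed.

Lemma etspan_t l s k z : etspan s (k - 1) z -> etspan (l :: s) k (t_ l * z).
Proof.
move=> Gz; rewrite -[_ * z]add0r -(mulr0 (e_ l)).
by apply: ETcons => //; apply: etspan0.
Qed.

Lemma etspan_swap l m s k z :
  etspan (l :: m :: s) k z -> etspan (m :: l :: s) k z.
Proof.
case/etspan_consP=> z1 [z2 [/etspan_consP[b [c [Gb Gc ->]]] Gz2 ->]].
have [d [f [Gd Gf ->]]] := etspan_consP Gz2.
have -> : e_ l * (e_ m * b + t_ m * c) + t_ l * (e_ m * d + t_ m * f) =
  e_ m * (e_ l * b + t_ l * d) + t_ m * (e_ l * c + t_ l * f) by ring.
by apply: ETcons; apply: ETcons.
Qed.

(** The rings being commutative, a list serves as a multiset of characters; this brings a chosen one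
    to the front. *)
Lemma etspan_catCA s1 l s2 k z :
  etspan (s1 ++ l :: s2) k z <-> etspan (l :: s1 ++ s2) k z.
Proof.
elim: s1 k z => [//|m s1 IH] k z; split.
  case/etspan_consP=> b [c [/IH Gb /IH Gc ->]].
  by apply: etspan_swap; apply: ETcons.
move/etspan_swap/etspan_consP=> [b [c [/IH Gb /IH Gc ->]]].
exact: ETcons.
Qed.

Lemma etspanM s u k j z w :
  etspan s k z -> etspan u j w -> etspan (s ++ u) (k + j) (z * w).
Proof.
move=> Gz Gw; elim: Gz => {s k z} [k|| l s k z z' _ IH _ IH'].
- by rewrite mul0r; apply: etspan0.
- by rewrite mul1r add0r.
by rewrite mulrDl -!mulrA; apply: ETcons => //; rewrite addrAC.
Qed.

Definition eprod u : F A := \prod_(l <- u) e_ l.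

Lemma etspan_eprod u s k z : etspan s k z -> etspan (u ++ s) k (eprod u * z).
Proof.
move=> Gz; rewrite /eprod; elim: u => [|l u IH]; first by rewrite big_nil mul1r.
by rewrite big_cons -mulrA; apply: etspan_e.
Qed.

Lemma eprod_reg u z :
  (forall l, List.In l u -> nontrivial l) -> eprod u * z = 0 -> z = 0.
Proof.
rewrite /eprod; elim: u => [|l u IH] ntu; first by rewrite big_nil mul1r.
rewrite big_cons -mulrA => /rE_reg e0; apply: IH => [m um|].
  by apply: ntu; right.
by apply: e0; apply: ntu; left.
Qed.

End OneGroup.

Lemma etspan_pb (B A : el2) (f : {multiplicative B -> A}) s k (z : F A) :
  etspan s k z ->
  etspan (map (chpb f) s) k (rpb f z).
Proof.
elim=> {s k z} [k||l s k z w _ IH _ IH'].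
- by rewrite rpb0; apply: etspan0.
- by rewrite rpb1; apply: ETnil1.
by rewrite rpbD !rpbM rpb_euler rpb_thom; apply: ETcons.
Qed.

(** A polynomial in pulled back characters is lifted by writing the same expression in the original
    ones; no exactness is involved. *)
Lemma etspan_lift (B A : el2) (f : {multiplicative B -> A}) s k (z : F B) :
  etspan (map (chpb f) s) k z ->
  exists2 w, etspan s k w & rpb f w = z.
Proof.
elim: s k z => [|l s IH] k z /=.
  case/etspan_nilP=> [->|[-> ->]].
    by exists 0; [apply: etspan0|apply: rpb0].
  by exists 1; [apply: ETnil1|apply: rpb1].
case/etspan_consP=> _ [_ [/IH[b Gb <-] /IH[c Gc <-] ->]].
exists (e_ l * b + t_ l * c); first exact: ETcons.
by rewrite rpbD !rpbM rpb_euler rpb_thom.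
Qed.

End FamilyTheory.

Lemma sign_mul (b c : el2_C) :
  ((b * c)%g == 1%g) = ((b == 1%g) == (c == 1%g)).
Proof. by case: b c => [] []. Qed.

Lemma sign_neq1 (b : el2_C) : b != 1%g -> b = true. Proof. by case: b. Qed.

(** * Projection onto the kernel of a character *)

Section Retraction.
Variables (A : el2) (l : el2char A) (g : A).
Hypothesis lg : l g != 1%g.

(* The projection onto [ker l] with kernel generated by [g]. *)
Definition shift_fun (x : A) : A := (if l x == 1 then x else x * g)%g.

Lemma shift_ker x : shift_fun x \in kerl l.
Proof.
rewrite inE /shift_fun; case: ifPn => // lx.
by rewrite gmulfM sign_mul (negPf lx) (negPf lg).
Qed.

Lemma shift_funM : {morph shift_fun : x y / (x * y)%g}.
Proof.
move=> x y; rewrite /shift_fun gmulfM sign_mul.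
case: (l x == _); case: (l y == _) => //=.
- by rewrite mulgA.
- by rewrite -!mulgA (el2_commute y).
rewrite -mulgA (mulgA g) (el2_commute g) -(mulgA y) -[(g * g)%g]/(g ^+ 2)%g.
by rewrite el2_sqr mulg1.
Qed.

Definition retr (x : A) : el2_sub (kerl l) := Subg (shift_ker x).

Lemma retrM : {morph retr : x y / (x * y)%g}.
Proof. by move=> x y; apply: val_inj; apply: shift_funM. Qed.
HB.instance Definition _ :=
  isMultiplicative.Build A (el2_sub (kerl l)) retr retrM.

Definition shift : {multiplicative A -> A} := @sub_incl A (kerl l) \o retr.

Lemma shiftE (n : el2char A) x :
  n (shift x) = (if l x == 1 then n x else n x * n g)%g.
Proof.
by rewrite /shift /= /shift_fun /sub_incl /=; case: ifP; rewrite ?gmulfM.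
Qed.

Lemma shift_low (n : el2char A) : n g = 1%g -> chpb shift n = n.
Proof.
move=> ng; apply: multiplicative_eq => x /=.
by rewrite [LHS]shiftE ng mulg1 if_same.
Qed.

Lemma shift_g (n : el2char A) : chpb shift n g = 1%g.
Proof. by rewrite [LHS]shiftE (negPf lg) [RHS]/=; case: (n g). Qed.

(** Outside [ker l] the shift multiplies by [g], where [n] takes the value -1; hence [n] and its
    shift differ by the sign [l x]. *)
Lemma shift_top (n : el2char A) : n g != 1%g ->
  forall x, n x = (l x * chpb shift n x)%g.
Proof.
move=> /sign_neq1 ng x; rewrite [chpb _ _ _]shiftE ng.
by case: (l x); case: (n x).
Qed.

Lemma shift_l : ~ nontrivial (chpb shift l).
Proof.
case=> x; rewrite [chpb _ _ _]shiftE (sign_neq1 lg).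
by case: (l x).
Qed.

Lemma incl_ker : ~ nontrivial (chpb (@sub_incl A (kerl l)) l).
Proof.
by case=> x; have := valP x; rewrite inE => /eqP lx; rewrite [chpb _ _ _]lx.
Qed.

Lemma card_ker : (#|el2_sub (kerl l)| < #|A|)%N.
Proof.
rewrite card_sub -cardsT proper_card // properT.
by apply/eqP => /setP/(_ g); rewrite !inE (negPf lg).
Qed.

End Retraction.

(** * Vanishing of null polynomials *)

Section Injectivity.
Variable F : ring_family.
Local Notation e_ l := (fam_euler F l).
Local Notation t_ l := (fam_thom F l).

Definition top (A : el2) (g : A) (l : el2char A) : bool := l g != 1%g.

(** Formally, with y = e/t, additivity says that y_m = y_l + y_n, and this is the partial fraction
    identity 1/(y_l y_m) = 1/(y_l y_n) + 1/(y_n y_m) with denominators cleared. *)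
Lemma euler_thom_swap (A : el2) (l m n : el2char A) :
  (forall x, m x = (l x * n x)%g) ->
  t_ l * e_ n * t_ m = t_ l * e_ m * t_ n + e_ l * (t_ n * t_ m).
Proof.
move=> lmn; apply/eqP; rewrite -subr_eq0.
have opp z : - z = z :> F A by apply/eqP; rewrite -subr_eq0 -opprD rf_char2 oppr0.
rewrite opp -[X in _ == X](euler_thom_rel F lmn); apply/eqP; ring.
Qed.

(* Modulo [e_ l], the relation [euler_thom_swap] exchanges a character [n] with
   [n * l] inside a multiple of [t_ l], at the cost of Euler classes. Applied to
   every character nontrivial at [g], it turns [c] into [rpb (shift lg) c]. *)
Lemma thom_eprod_shift (A : el2) (l : el2char A) (g : A) (lg : l g != 1%g)
    (s : seq (el2char A)) :
  exists u : seq (el2char A),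
    [/\ ~~ has (top g) u, forall n, List.In n u -> nontrivial n
      & exists y, forall k (c : F A), etspan s k c ->
          exists2 w, etspan (u ++ s) (k + 1) w &
            t_ l * eprod F u * c = t_ l * y * rpb (shift lg) c + e_ l * w].
Proof.
elim: s => [|n s [u [u_low u_nt [y IH]]]].
  exists [::]; split=> //; exists 1 => k c Gc.
  exists 0; first exact: etspan0.
  by case/etspan_nilP: Gc => [|[_]] ->; rewrite /eprod big_nil ?rpb0 ?rpb1; ring.
have [ng|ng] := eqVneq (n g) 1%g.
  exists u; split=> //; exists y => k c.
  case/etspan_consP=> c1 [c2 [/IH[w1 Gw1 E1] /IH[w2 Gw2 E2] ->]].
  exists (e_ n * w1 + t_ n * w2).
    by apply/etspan_catCA/ETcons => //; rewrite addrAC.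
  rewrite rpbD !rpbM rpb_euler rpb_thom shift_low //.
  transitivity (e_ n * (t_ l * eprod F u * c1) + t_ n * (t_ l * eprod F u * c2)).
    ring.
  by rewrite E1 E2; ring.
(* The shift sends [e_ l] to 0 and [t_ l] to 1: for [n = l] the term with [e_ l] goes into the
   remainder, and [y] takes over the factor [t_ l]. *)
have [nl|n_nl] := pselect (n =1 l).
  have {nl}-> : n = l by exact: multiplicative_eq.
  exists u; split=> //; exists (t_ l * y) => k c.
  case/etspan_consP=> c1 [c2 [Gc1 /IH[w2 Gw2 E2] ->]].
  exists (t_ l * (eprod F u * c1 + w2)).
    apply/etspan_catCA/etspan_t/etspanD.
      by rewrite addrK; apply: etspan_eprod.
    by rewrite subrK in Gw2; rewrite addrK.
  rewrite rpbD !rpbM rpb_euler rpb_thom.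
  rewrite (fam_euler_trivial F (@shift_l A l g lg)).
  rewrite (fam_thom_trivial F (@shift_l A l g lg)).
  transitivity (e_ l * (t_ l * eprod F u * c1) + t_ l * (t_ l * eprod F u * c2)).
    ring.
  by rewrite E2; ring.
set n' := chpb (shift lg) n.
(* [euler_thom_swap] turns [t_ l * e_ n' * t_ n] into [t_ l * e_ n * t_ n'] modulo [e_ l], hence
   [n'] is added to [u] and [e_ n] to [y]. The character [n'] is trivial at [g] by construction, and
   nontrivial because [n] is not [l]. *)
exists (n' :: u); split.
- by rewrite /= negb_or u_low andbT /top shift_g eqxx.
- move=> m [<-|/u_nt//]; apply: contrapT => tn'.
  apply: n_nl => x; rewrite (shift_top lg ng) -/n'.
  have /eqP-> : n' x == 1%g by apply: contra_notT tn' => nx; exists x.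
  by rewrite mulg1.
exists (e_ n * y) => k c; case/etspan_consP=> c1 [c2 [/IH[w1 Gw1 E1] Gc2 ->]].
have [w2 Gw2 E2] := IH _ _ Gc2; rewrite subrK in Gw2.
exists (e_ n' * (e_ n * w1) + t_ n' * (e_ n * w2 + t_ n * (eprod F u * c2))).
  apply: ETcons; first by apply/etspan_catCA/etspan_e.
  rewrite addrK; apply/etspan_catCA/ETcons => //.
  exact: etspan_eprod.
have sw := euler_thom_swap (shift_top lg ng); rewrite -/n' in sw.
rewrite rpbD !rpbM rpb_euler rpb_thom -/n' /eprod big_cons -/(eprod F u).
transitivity (e_ n' * e_ n * (t_ l * eprod F u * c1)
  + (t_ l * e_ n' * t_ n) * (eprod F u * c2)); first by ring.
rewrite sw E1.
transitivity (e_ n' * e_ n * (t_ l * y * rpb (shift lg) c1 + e_ l * w1) +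
  e_ n * t_ n' * (t_ l * eprod F u * c2)
  + e_ l * (t_ n' * t_ n) * (eprod F u * c2)).
  by ring.
by rewrite E2; ring.
Qed.

(** In the application [N z] says that the component of [z] in [H] is zero. This is a proper ideal,
    stable under restriction, from which Euler classes can be cancelled. *)
Variable N : forall A : el2, F A -> Prop.
Hypothesis N_pb : forall (B A : el2) (f : {multiplicative B -> A}) (z : F A),
  N z -> N (rpb f z).
Hypothesis N_mul : forall (A : el2) (y z : F A), N z -> N (y * z).
Hypothesis N_reg : forall (A : el2) (l : el2char A) (z : F A),
  nontrivial l -> N (e_ l * z) -> N z.
Hypothesis N1 : forall A : el2, ~ N (1 : F A).

Lemma etspan_trivial (A : el2) (s : seq (el2char A)) k (z : F A) :
  (forall l, List.In l s -> ~ nontrivial l) -> etspan s k z -> z = 0 \/ z = 1.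
Proof.
move=> + Gz; elim: Gz => {s k z} [k||l s k z w _ IH _ IH'] triv.
- by left.
- by right.
have trl : ~ nontrivial l by apply: triv; left.
rewrite fam_euler_trivial // fam_thom_trivial // mul0r mul1r add0r.
by apply: IH' => n sn; apply: triv; right.
Qed.

Lemma etspan_shift (A : el2) (l : el2char A) (g : A) (lg : l g != 1%g)
    (s : seq (el2char A)) k (z : F A) :
  ~~ has (top g) s -> etspan s k z -> rpb (shift lg) z = z.
Proof.
move=> + Gz; elim: Gz => {s k z} [k||n s k z w _ IH _ IH'] /=.
- by rewrite rpb0.
- by rewrite rpb1.
rewrite negb_or negbK => /andP[/eqP ng slow].
by rewrite rpbD !rpbM rpb_euler rpb_thom shift_low // IH ?IH'.
Qed.

(* If [z = e_ l * b + t_ l * c] is null, in the sense of [N], then so is its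
   restriction [c] to [ker l], which vanishes by induction on the group. Hence
   [thom_eprod_shift] exhibits [eprod u * z] as [e_ l] times a null element with
   one character less that is nontrivial at [g]. Without such characters, [z] is
   pulled back from [ker l]. *)
Lemma etspan_inj (A : el2) (s : seq (el2char A)) k (z : F A) :
  etspan s k z -> N z -> z = 0.
Proof.
have [c] := ubnP #|A|; elim: c => // c IHc in A s k z *; rewrite ltnS => leAc.
have [[l0 [_ [g lg]]]|trivs] := pselect (exists l, List.In l s /\ nontrivial l);
  last first.
  move=> Gz Nz; have [//|z1] : z = 0 \/ z = 1.
    by apply: etspan_trivial Gz => l sl ntl; apply: trivs; exists l.
  by rewrite z1 in Nz; case: (N1 Nz).
have IHK (l : el2char A) (lg' : l g != 1%g) s' k' z' : etspan s' k' z' -> N z' ->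
    rpb (@sub_incl A (kerl l)) z' = 0.
  move=> Gz' Nz'; apply: IHc (etspan_pb _ Gz') (N_pb _ Nz').
  exact: leq_trans (card_ker lg') leAc.
have [d] := ubnP (count (top g) s); elim: d => // d IHd in s k z *.
rewrite ltnS => le_sd Gz Nz.
have [top_s|slow] := boolP (has (top g) s); last first.
  rewrite -(etspan_shift lg slow Gz) rpb_comp.
  by rewrite (IHK _ lg _ _ _ Gz Nz) rpb0.
have [i lt_is top_i] := has_nthP l0 top_s; pose l := nth l0 s i.
have Es : s = take i s ++ l :: drop i.+1 s by rewrite -drop_nth // cat_take_drop.
have lg1 : l g != 1%g := top_i.
move: Gz; rewrite Es => /etspan_catCA; set s' := take i s ++ _ => Gz.
have [b [a [Gb Ga Ez]]] := etspan_consP Gz.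
have a0 : rpb (shift lg1) a = 0.
  have := IHK _ lg1 _ _ _ Gz Nz.
  rewrite Ez rpbD !rpbM rpb_euler rpb_thom (fam_euler_trivial F (@incl_ker A l)).
  rewrite (fam_thom_trivial F (@incl_ker A l)) mul0r mul1r add0r => a0.
  by rewrite rpb_comp a0 rpb0.
have [u [u_low u_nt [y /(_ _ _ Ga)[w Gw Ew]]]] := thom_eprod_shift lg1 s'.
rewrite subrK in Gw; rewrite a0 mulr0 add0r in Ew.
have Euz : eprod F u * z = e_ l * (eprod F u * b + w).
  transitivity (e_ l * (eprod F u * b) + t_ l * eprod F u * a).
    by rewrite Ez; ring.
  by rewrite Ew mulrDr.
apply: (eprod_reg u_nt); rewrite Euz; suff -> : eprod F u * b + w = 0.
  exact: mulr0.
apply: (IHd (u ++ s') k).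
(* [u] adds no character nontrivial at [g], while [l] has been removed. *)
- apply: leq_trans le_sd; rewrite Es -/l !count_cat /= -/(top g l) [top g l]top_i.
  move: u_low; rewrite has_count -eqn0Ngt => /eqP->.
  by rewrite add0n add1n addnS.
- by apply: etspanD => //; apply: etspan_eprod.
by apply: (@N_reg _ l); [exists g|rewrite -Euz; apply: N_mul].
Qed.

End Injectivity.

(** * Degrees *)

Lemma sqr_eq1 (R : idomainType) (x : R) : x ^+ 2 = 1 -> x = 1 \/ x = -1.
Proof. by move/eqP; rewrite sqrf_eq1 => /orP[]/eqP; [left|right]. Qed.

Lemma signr_inj (R : numDomainType) (b c : bool) :
  (-1) ^+ b = (-1) ^+ c :> R -> b = c.
Proof.
have ne1 : 1 != -1 :> R by rewrite -addr_eq0 (pnatr_eq0 _ 2).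
by case: b c => [] [] //; rewrite expr0 expr1 => e; case/eqP: ne1.
Qed.

(** * Representations as sums of characters *)

Section CharacterSums.
Variable R : realType.

Lemma row_free1 n : row_free (1%:M : 'M[R]_n).
Proof. by rewrite row_free_unit unitmx1. Qed.

Lemma rclass_chpb (B A : el2) (f : {multiplicative B -> A}) (l : el2char A) :
  rclass (pbrep f (chrep R l)) = rclass (chrep R (chpb f l)).
Proof.
apply: rclass_rsim; exists 1%:M; [by []|exact: row_free1|move=> h _].
by rewrite mulmx1 mul1mx.
Qed.

Lemma rclass_trivial (A : el2) (l : el2char A) : ~ nontrivial l ->
  rclass (chrep R l) = rclass (triv1 R A).
Proof.
move=> triv_l; apply: rclass_rsim.
exists 1%:M; [by []|exact: row_free1|move=> h _].
rewrite mulmx1 mul1mx /=; have /eqP-> // : l h == 1%g.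
by apply: contra_notT triv_l => lh; exists h.
Qed.

Lemma rclass_deg0 (A : el2) (V : rrep R A) : rdegree V = 0 -> rclass V = 0.
Proof.
case: V => n V /= n0; subst n; rewrite -(rclass0 R A); apply: rclass_rsim.
by exists 0 => // [|g _]; rewrite ?flatmx0 ?thinmx0 // /row_free mxrank0.
Qed.

Lemma rclass_diag (A : el2) n (V : mx_representation R [set: A] n)
    (l : 'I_n -> el2char A) :
  (forall g, V g = diag_mx (\row_i (-1) ^+ (l i g : bool))) ->
  rclass (Representation V) = \sum_(i < n) rclass (chrep R (l i)).
Proof.
elim: n V l => [|n IHn] V l diagV; first by rewrite big_ord0 rclass_deg0.
rewrite big_ord_recl.
have W_repr : mx_repr [set: A]
    (fun g => diag_mx (\row_(i < n) (-1) ^+ (l (fintype.lift ord0 i) g : bool))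
      : 'M[R]_n).
  split=> [|x y _ _].
    apply/matrixP => i j; rewrite !mxE ghom1; by [].
  rewrite mulmx_diag; congr diag_mx; apply/rowP => i; rewrite !mxE gmulfM.
  by rewrite [(l _ x * l _ y)%g]/(l _ x (+) l _ y) signr_addb.
rewrite -(IHn (MxRepresentation W_repr)) // -rclass_dadd.
apply: rclass_rsim; exists 1%:M; [by []|exact: row_free1|move=> g _].
rewrite mulmx1 mul1mx diagV /=.
rewrite -diag_const_mx -diag_mx_row; congr diag_mx.
apply/rowP => i; rewrite !mxE; case: splitP => j; rewrite !mxE.
  by rewrite ord1 => i0; congr (_ ^+ (l _ g)); apply: val_inj.
by move=> ij; congr (_ ^+ (l _ g)); apply: val_inj.
Qed.

(** The matrices [V g] commute and are annihilated by (X - 1)(X + 1), whose roots are distinct. *)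
Lemma codiag_rep (A : el2) n (V : mx_representation R [set: A] n) :
  exists2 P, P \in unitmx & forall g, is_diag_mx (P *m V g *m invmx P).
Proof.
have /codiagonalizableP[P Pu /allP diagP] :
  {in [seq V g | g : A] &, forall B C, comm_mx B C} /\
  {in [seq V g | g : A], forall B, diagonalizable B}.
  split=> [_ _ /imageP[x _ ->] /imageP[y _ ->]|_ /imageP[x _ ->]].
    by rewrite /comm_mx -!repr_mxM ?inE // el2_commute.
  (* [mxminpoly] concerns matrices of nonzero size, so size 0 is treated apart. *)
  case: n V => [|n] V; first by rewrite [V x]thinmx0; apply: diagonalizable0.
  apply/diagonalizableP; exists [:: 1; -1].
    by rewrite /= inE andbT -addr_eq0 (pnatr_eq0 _ 2).
  apply: mxminpoly_min; rewrite !big_cons big_nil mulr1 rmorphM /=.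
  rewrite !rmorphB /= !horner_mx_X !horner_mx_C.
  have VV : V x * V x = 1.
    by rewrite -mulmxE -repr_mxM ?inE // -[(x * x)%g]/(x ^+ 2)%g el2_sqr repr_mx1.
  rewrite raddfN /= opprK mulrDr mulrBl mulrBl VV.
  by rewrite !mulr1 !mul1r addrC subrKA subrr.
exists P => // g; have := diagP _ (image_f V (isT : g \in A)).
by rewrite inE -conjumx.
Qed.

Lemma rclass_chars (A : el2) (V : rrep R A) :
  exists s : seq (el2char A), rclass V = \sum_(l <- s) rclass (chrep R l).
Proof.
case: V => n V; have [P Pu diagP] := codiag_rep V.
pose d g i := (P *m V g *m invmx P) i i.
have dM x y i : d (x * y)%g i = d x i * d y i.
  rewrite /d repr_mxM ?inE //.
  have -> : P *m (V x *m V y) *m invmx P =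
      (P *m V x *m invmx P) *m (P *m V y *m invmx P).
    by rewrite !mulmxA mulmxKV.
  have [/diag_mxP[D ->] /diag_mxP[E ->]] := (diagP x, diagP y).
  by rewrite mulmx_diag !mxE eqxx !mulr1n.
have d1 i : d 1%g i = 1.
  by rewrite /d repr_mx1 mulmx1 mulmxV // mxE eqxx.
(* Diagonal entries square to 1, hence are signs; the boolean [d g i != 1] is then the value in
   [sign_gp] of the character sought. *)
have dsg g i : d g i = (-1) ^+ (d g i != 1).
  have := dM g g i; rewrite -[(g * g)%g]/(g ^+ 2)%g el2_sqr d1 => /esym.
  move/sqr_eq1=> [|] ->; first by rewrite eqxx.
  by rewrite eq_sym -addr_eq0 (pnatr_eq0 _ 2).
have chM i : {morph (fun g => (d g i != 1) : el2_C) : x y / (x * y)%g}.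
  move=> x y; apply: (@signr_inj R).
  by rewrite [RHS]signr_addb -!dsg dM.
pose h i : A -> el2_C := fun g => d g i != 1.
pose l i : el2char A := HB.pack_for {multiplicative A -> el2_C} (h i)
  (isMultiplicative.Build A el2_C (h i) (chM i)).
exists [seq l i | i <- enum 'I_n]; rewrite big_map big_enum /=.
have W_repr : mx_repr [set: A] (fun g => P *m V g *m invmx P).
  split=> [|x y _ _]; first by rewrite repr_mx1 mulmx1 mulmxV.
  by rewrite repr_mxM ?inE // !mulmxA mulmxKV.
rewrite -(@rclass_diag _ _ (MxRepresentation W_repr)).
  apply: rclass_rsim; exists (invmx P) => //.
    by rewrite row_free_unit unitmx_inv.
  by move=> g _ /=; rewrite !mulmxA mulVmx // mul1mx.
move=> g /=; have /diag_mxP[D ED] := diagP g; rewrite ED; congr diag_mx.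
apply/rowP => i; rewrite !mxE; transitivity (d g i); last exact: dsg.
by rewrite /d ED mxE eqxx mulr1n.
Qed.

End CharacterSums.

(** * Virtual characters *)

Section Trace.
Variables (R : realType) (A : el2) (g : A).

Notation freerep := {freeg {classic rrep R A} / int}.

(** [zmodule R] is [R] as a module over [int], as [fglift] demands. *)
Definition tr_free : freerep -> (zmodule R) :=
  fglift (fun V : {classic rrep R A} => \tr ((V : rrep R A) g) : (zmodule R)).

Lemma tr_free_zmod_morphism : zmod_morphism tr_free.
Proof. exact: lift_is_additive. Qed.
HB.instance Definition _ :=
  GRing.isZmodMorphism.Build freerep (zmodule R) tr_free tr_free_zmod_morphism.

Lemma tr_free_gen (V : rrep R A) : tr_free (frgen V) = \tr (V g).
Proof. by rewrite /tr_free /frgen liftU scale1r. Qed.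

Lemma tr_free_rel (D : freerep) : RO_rel D -> tr_free D = 0.
Proof.
elim=> [|{}D E _ rD _ rE|V W simVW|V W]; rewrite ?raddf0 ?raddfB //=.
- by rewrite rD rE subr0.
- by rewrite !tr_free_gen (mxtrace_rsim simVW) ?inE // subrr.
rewrite !tr_free_gen mxtrace_block.
by rewrite -addrA -opprD subrr.
Qed.

Definition tr_RO (m : RO R A) : (zmodule R) := tr_free (repr m).

Lemma tr_RO_pi (D : freerep) : tr_RO (piRO D) = tr_free D.
Proof.
apply/eqP; rewrite -subr_eq0 -raddfB; apply/eqP/tr_free_rel/piROP.
by rewrite /piRO reprK.
Qed.

Lemma tr_RO_zmod_morphism : zmod_morphism tr_RO.
Proof.
move=> m n; have [D ->] := piRO_surj m; have [E ->] := piRO_surj n.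
by rewrite -raddfB !tr_RO_pi raddfB.
Qed.
HB.instance Definition _ :=
  GRing.isZmodMorphism.Build (RO R A) (zmodule R) tr_RO tr_RO_zmod_morphism.

Lemma tr_RO_rclass (V : rrep R A) : tr_RO (rclass V) = \tr (V g).
Proof. by rewrite [LHS]tr_RO_pi tr_free_gen. Qed.

End Trace.

(** * Multiplicities of characters in a degree *)

Section CharacterDegrees.
Variable R : realType.

Notation neg l := (subI 0 (chrep R l)).

Lemma val_neg (A : el2) (l : el2char A) : neg l = - rclass (chrep R l) :> RO R A.
Proof. by rewrite /= /subRO mulr0z add0r. Qed.

Lemma ro_of_inj (A : el2) : injective (@ro_of R A).
Proof. exact: val_inj. Qed.

Definition cdeg (A : el2) (s : seq (el2char A)) (k : int) : IRO R A :=
  foldr (fun l m => m + neg l) (constI R A k) s.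

Lemma val_cdeg (A : el2) (s : seq (el2char A)) k :
  cdeg s k = rclass (triv1 R A) *~ k - \sum_(l <- s) rclass (chrep R l) :> RO R A.
Proof.
elim: s => [|l s IH]; first by rewrite big_nil subr0 val_constI.
rewrite big_cons opprD addrCA addrC -IH -val_neg; by [].
Qed.

Lemma cdegD (A : el2) (s s' : seq (el2char A)) k k' :
  cdeg (s ++ s') (k + k') = cdeg s k + cdeg s' k'.
Proof.
apply: ro_of_inj; rewrite val_cdeg.
transitivity (ro_of (cdeg s k) + ro_of (cdeg s' k')); last by [].
rewrite !val_cdeg.
by rewrite big_cat mulrzDr opprD addrACA.
Qed.

Lemma cdeg_pb (B A : el2) (f : {multiplicative B -> A}) (s : seq (el2char A)) k :
  pbI f (cdeg s k) = cdeg (map (chpb f) s) k.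
Proof.
apply: ro_of_inj; rewrite val_cdeg.
transitivity (pbRO f (ro_of (cdeg s k))); first by [].
rewrite val_cdeg raddfB /= raddfMz /= pbRO_triv1 raddf_sum big_map; congr (_ - _).
by apply: eq_bigr => l _; rewrite /= pbRO_rclass rclass_chpb.
Qed.

Lemma cdeg_trivial (A : el2) (l : el2char A) (s : seq (el2char A)) k :
  ~ nontrivial l -> cdeg (l :: s) k = cdeg s (k - 1).
Proof.
move=> triv; apply: ro_of_inj; rewrite !val_cdeg big_cons rclass_trivial //.
by rewrite mulrzBr mulr1z opprD addrA.
Qed.

Lemma cdeg_thom (A : el2) (l : el2char A) (s : seq (el2char A)) k :
  subI 1 (chrep R l) + cdeg s (k - 1) = cdeg (l :: s) k.
Proof.
apply: ro_of_inj; rewrite val_cdeg big_cons.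
transitivity (subRO 1 (chrep R l) + ro_of (cdeg s (k - 1))); first by [].
rewrite val_cdeg /subRO.
by rewrite mulrzBr !mulr1z addrACA [X in X + _]addrC subrK opprD.
Qed.

Lemma cdeg_surj (A : el2) (m : IRO R A) : exists s k, m = cdeg s k.
Proof.
case: m => m /[dup] /asboolP[k [V ->]] mI; have [s Vs] := rclass_chars V.
by exists s, k; apply: ro_of_inj; rewrite val_cdeg /= -Vs.
Qed.

Definition sgn (b : el2_C) : R := (-1) ^+ (b : bool).

Lemma sgnM b c : sgn (b * c)%g = sgn b * sgn c.
Proof. exact: signr_addb. Qed.

Lemma tr_cdeg (A : el2) (s : seq (el2char A)) k g :
  tr_RO g (cdeg s k) = k%:~R - \sum_(l <- s) sgn (l g) :> R.
Proof.
rewrite val_cdeg raddfB /= raddfMz raddf_sum /= tr_RO_rclass.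
congr (_ - _); first by rewrite mxtrace1.
by apply: eq_bigr => l _; rewrite tr_RO_rclass mxtrace_scalar.
Qed.

(** Translation by an element where [l] is -1 changes the sign of the sum. *)
Lemma sum_sgn (A : el2) (l : el2char A) : nontrivial l -> \sum_g sgn (l g) = 0.
Proof.
case=> h lh; have sh : sgn (l h) = -1 by move: lh; case: (l h).
have : \sum_g sgn (l g) = - \sum_g sgn (l g).
  rewrite -mulN1r mulr_sumr (reindex_inj (mulgI h)) /=.
  by apply: eq_bigr => g _; rewrite gmulfM sgnM sh.
by move/eqP; rewrite -addr_eq0 -mulr2n mulrn_eq0 => /eqP.
Qed.

Lemma sum_sgn2 (A : el2) (l n : el2char A) :
  \sum_g sgn (l g) * sgn (n g) = (#|A| * `[< l = n >])%:R.
Proof.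
case: asboolP => [<-|ne_ln].
  rewrite muln1 -sum1_card natr_sum; apply: eq_bigr => g _.
  by rewrite -sgnM; case: (l g).
pose ln := mul_hom \o pair_hom l n : el2char A.
rewrite muln0 -[RHS](@sum_sgn _ ln).
  by apply: eq_bigr => g _; rewrite -sgnM.
apply: contrapT => triv; apply: ne_ln; apply: multiplicative_eq => g.
have : (l g * n g == 1)%g by apply: contra_notT triv => lng; exists g.
by case: (l g); case: (n g).
Qed.

(** The inner product of the virtual character with [l] is the multiplicity up to the factor
    [- #|A|]; the constant part contributes nothing as [l] is nontrivial. *)
Lemma cdeg_count (A : el2) (s s' : seq (el2char A)) k k' (l : el2char A) :
  cdeg s k = cdeg s' k' -> nontrivial l ->
  count (fun n => `[< l = n >]) s = count (fun n => `[< l = n >]) s'.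
Proof.
move=> eq_ss' ntl.
have sumE (u : seq (el2char A)) j :
    \sum_g sgn (l g) * tr_RO g (cdeg u j : RO R A) =
    - (#|A| * count (fun n => `[< l = n >]) u)%:R.
  under eq_bigr do rewrite tr_cdeg mulrBr.
  rewrite sumrB -mulr_suml sum_sgn // mul0r sub0r; congr (- _).
  under eq_bigr do rewrite mulr_sumr.
  rewrite exchange_big /= -sum1_count big_distrr /= natr_sum [RHS]big_mkcond /=.
  by apply: eq_bigr => n _; rewrite sum_sgn2; case: asboolP; rewrite ?muln0.
have := sumE s k; rewrite eq_ss' sumE => /oppr_inj/eqP.
rewrite eqr_nat eqn_pmul2l; first by move/eqP.
by apply/card_gt0P; exists 1%g.
Qed.

(** Both sides are the virtual dimension, the trace at 1. *)
Lemma cdeg_size (A : el2) (s s' : seq (el2char A)) k k' :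
  cdeg s k = cdeg s' k' -> k - (size s)%:Z = k' - (size s')%:Z.
Proof.
move=> eq_ss'; have sumE (u : seq (el2char A)) j :
    tr_RO 1%g (cdeg u j : RO R A) = (j - (size u)%:Z)%:~R.
  rewrite tr_cdeg rmorphB /=; congr (_ - _).
  rewrite -[RHS]/((size u)%:R) -sum1_size natr_sum.
  by apply: eq_bigr => l _; rewrite /sgn ghom1.
by have := sumE s k; rewrite eq_ss' sumE => /intr_inj.
Qed.

End CharacterDegrees.

(** * Dependence of the span on the degree only *)

Section ListChange.
Variables (R : realType) (F : ring_family) (A : el2).
Implicit Types (s u : seq (el2char A)) (k : int) (z : F A).

Local Notation same l := (fun n : el2char A => `[< l = n >]).
Local Notation nt := (fun n : el2char A => `[< nontrivial n >]).

Lemma etspan_count s u k z :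
  (forall l, count (same l) s = count (same l) u) ->
  size s = size u /\ (etspan s k z -> etspan u k z).
Proof.
elim: s u k z => [|l s IH] u k z eq_su.
  case: u eq_su => [//|n u] /(_ n) /=; rewrite asboolT //.
have [i lt_iu /asboolP li] : exists2 i, (i < size u)%N & `[< l = nth l u i >].
  by apply: (@has_nthP _ (same l) u l _); rewrite has_count -eq_su /= asboolT.
have eq_s : exists u1 u2, u = u1 ++ l :: u2.
  exists (take i u), (drop i.+1 u).
  by rewrite [in l :: _]li -drop_nth // cat_take_drop.
have [u1 [u2 Eu]] := eq_s; have {IH}IH k' z' : size s = size (u1 ++ u2) /\
    (etspan s k' z' -> etspan (u1 ++ u2) k' z').
  apply: IH => n; have := eq_su n; rewrite Eu !count_cat /= addnCA.
  exact: addnI.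
split; first by rewrite /= (IH 0 0).1 Eu !size_cat addnS.
case/etspan_consP=> b [c [/(IH _ _).2 Gb /(IH _ _).2 Gc ->]].
by rewrite Eu; apply/etspan_catCA/ETcons.
Qed.

(** A trivial [l] has [e_ l = 0] and [t_ l = 1], so it may be dropped while [k] decreases by one. *)
Lemma etspan_filter s k z :
  etspan s k z <-> etspan (filter nt s) (k - (count (predC nt) s)%:Z) z.
Proof.
elim: s k z => [|l s IH] k z /=; first by rewrite subr0.
case: asboolP => ntl /=.
  rewrite add0n; split=> /etspan_consP[b [c [Gb Gc ->]]]; apply: ETcons.
  - exact/IH.
  - by rewrite addrAC; apply/IH.
  - exact/IH.
  - by apply/IH; rewrite addrAC.
rewrite PoszD opprD addrA -IH; split=> [/etspan_consP[b [c [Gb Gc ->]]]|Gz].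
  by rewrite fam_euler_trivial // fam_thom_trivial // mul0r mul1r add0r.
by rewrite -[z]mul1r -(fam_thom_trivial F ntl); apply: etspan_t.
Qed.

(** After the trivial characters are dropped, both lists have the same multiplicities by
    [cdeg_count], and the shifted integers agree by [cdeg_size]. *)
Lemma etspan_cdeg s u k j z :
  cdeg R s k = cdeg R u j -> etspan s k z -> etspan u j z.
Proof.
move=> eq_su.
have cnt l : count (same l) (filter nt s) = count (same l) (filter nt u).
  rewrite !count_filter; have [ntl|trl] := pselect (nontrivial l).
    have nt_same n : predI (same l) nt n = same l n.
      by rewrite /=; case: asboolP => //= <-; apply/asboolP.
    by rewrite !(eq_count nt_same); apply: cdeg_count eq_su ntl.
  have nt_same n : predI (same l) nt n = pred0 n.
    by rewrite /=; case: asboolP => //= <-; apply/asboolPn.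
  by rewrite !(eq_count nt_same) !count_pred0.
move=> /etspan_filter Gz; apply/etspan_filter.
have [eq_size _] := etspan_count 0 0 cnt.
suff <- : k - (count (predC nt) s)%:Z = j - (count (predC nt) u)%:Z.
  exact: (etspan_count _ _ cnt).2 Gz.
have := cdeg_size eq_su; rewrite -(count_predC nt s) -(count_predC nt u).
rewrite -(size_filter nt s) -(size_filter nt u) eq_size !PoszD !opprD.
by rewrite ![_ + (- _ - _)]addrCA => /addrI.
Qed.

End ListChange.

(** * Pairs of ring families *)

Section ProductFamily.
Variables F1 F2 : ring_family.

Definition prod_rf (A : el2) : comPzRingType := (F1 A * F2 A)%type.

Definition prod_pb (B A : el2) (f : {multiplicative B -> A}) (z : prod_rf A) :
  prod_rf B := (rpb f z.1, rpb f z.2).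

Definition prod_family : ring_family.
Proof.
refine (@RingFamily prod_rf prod_pb _ _ _ _ _ _
  (rE F1, rE F2) (rT F1, rT F2) _ _ _ _).
- by move=> B A f z w; congr (_, _); apply: rpbD.
- by move=> B A f z w; congr (_, _); apply: rpbM.
- by move=> B A f; congr (_, _); apply: rpb1.
- by move=> A [z w]; congr (_, _); apply: rpb_id.
- by move=> D B A g f [z w]; congr (_, _); apply: rpb_comp.
- by move=> A [z w]; congr (_, _); apply: rf_char2.
- by congr (_, _); apply: rE1.
- by congr (_, _); apply: rT1.
- by congr (_, _); apply: rET_mul.
by move=> A l ntl [z w] [/(rE_reg ntl)-> /(rE_reg ntl)->].
Defined.

(** With [F1] built from [H] and [F2] from [X]: a polynomial that vanishes in [H] vanishes in
    [X]. *)
Lemma prod_etspan_inj (A : el2) (s : seq (el2char A)) k (z : prod_family A) :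
  (forall B : el2, (1 : F1 B) <> 0) -> etspan s k z -> z.1 = 0 -> z = 0.
Proof.
pose N (B : el2) (w : prod_family B) := w.1 = 0.
move=> ne10 Gz; apply: (etspan_inj (N := N)) Gz; rewrite /N.
- by move=> D B f [z1 z2] /= ->; apply: rpb0.
- by move=> B [y1 y2] [z1 z2] /= ->; apply: mulr0.
- by move=> B l [z1 z2] ntl /= /(rE_reg ntl).
by move=> B /ne10.
Qed.

Lemma etspan_prod1 (A : el2) (s : seq (el2char A)) k (z : prod_family A) :
  etspan s k z -> etspan (F := F1) s k z.1.
Proof. by elim=> *; constructor. Qed.

Lemma etspan_prod2 (A : el2) (s : seq (el2char A)) k (z : prod_family A) :
  etspan s k z -> etspan (F := F2) s k z.2.
Proof. by elim=> *; constructor. Qed.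

End ProductFamily.

(** * Orientable algebras *)

Section OrientedRings.
Variables (R : realType) (X : orientable_alg R).

Notation neg l := (subI 0 (chrep R l)).
Local Notation T := (total X).
Local Notation a := (tin (pre_euler X) : T el2_C).
Local Notation incl l := (@sub_incl _ (kerl l)).

Lemma tin_euler (A : el2) (l : el2char A) :
  tin (euler (pre_euler X) l) = pb l a :> T A.
Proof. by rewrite (@pb_tin _ _ _ _ l _ _ (hchar R 0 l)). Qed.

Lemma tin_thom (t : X (Ob (subI 1 (sigma R)))) (A : el2) (l : el2char A) :
  tin (thom t l) = pb l (tin t) :> T A.
Proof. by rewrite (@pb_tin _ _ _ _ l _ _ (hchar R 1 l)). Qed.

Lemma tin_euler_mul (A : el2) (l : el2char A) m (x : X (Ob m)) :
  tin (euler_mul (pre_euler X) l x) = pb l a * tin x.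
Proof. by rewrite tin_cast tin_pmul tin_euler. Qed.

Lemma addIRO_inj (A : el2) (m n p : IRO R A) : m + p = n + p -> m = n.
Proof. by move/(congr1 (@ro_of R A))/(addIr (ro_of p))/ro_of_inj. Qed.

(** Degrees can be cancelled, so the component of [pb l a * z] at [m + neg l] comes from the
    component of [z] at [m] alone, where exactness applies. *)
Lemma euler_reg (A : el2) (l : el2char A) : nontrivial l ->
  forall z : T A, pb l a * z = 0 -> z = 0.
Proof.
move=> ntl z az0; apply: dsum_eq => m; rewrite dsum0.
have [inj_e _ _] := pre_eulerP X m ntl; apply: inj_e.
have e0 k : euler_mul (pre_euler X) l (0 : X (Ob k)) = 0.
  by apply: tin_inj; rewrite tin_euler_mul !tin0 mulr0.
rewrite e0; transitivity ((pb l a * z) (m + neg l)); last by rewrite az0 dsum0.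
elim/total_ind: z {az0} => [|z w IH IH'|n x].
- by rewrite mulr0 !dsum0 e0.
- rewrite mulrDr !dsumD -IH -IH'; apply: tin_inj.
  by rewrite tin_euler_mul !tinD mulrDr -!tin_euler_mul.
rewrite -tin_euler_mul; have [<-|ne_nm] := pselect (n = m).
  by rewrite !din_id.
rewrite !dinE !gcoef_neq //=; move/addIRO_inj; exact: ne_nm.
Qed.

Lemma euler_ker (A : el2) (l : el2char A) (m m' : IRO R A) (y : X (Ob m')) :
  nontrivial l -> m' = m + neg l -> pb (incl l) (tin y) = 0 ->
  exists x : X (Ob m), tin y = pb l a * tin x.
Proof.
move=> ntl Em; subst m' => y0; have [_ /(_ y)[ker_e _] _] := pre_eulerP X m ntl.
have [|x <-] := ker_e; last by exists x; rewrite tin_euler_mul.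
by apply: tin_inj; rewrite tin0 -y0 (@pb_tin _ _ _ _ _ _ _ (hker l m)).
Qed.

Lemma res_surj (A : el2) (l : el2char A) (m m' : IRO R A)
    (n : IRO R (el2_sub (kerl l))) (z : X (Ob n)) :
  nontrivial l -> m' = m + neg l -> n = pbI (incl l) m' ->
  exists y : X (Ob m'), pb (incl l) (tin y) = tin z.
Proof.
move=> ntl Em; subst m' => En; have [_ _ surj] := pre_eulerP X m ntl.
have := hker_subproof l m; rewrite -En => En'.
have [y Ey] := surj (castX En' z); exists y.
by rewrite (@pb_tin _ _ _ _ _ _ _ (hker l m)) // Ey tin_cast.
Qed.

Lemma nt_sigma : nontrivial (idfun : el2char el2_C).
Proof. by exists true. Qed.

Lemma ker_sigma (x : el2_sub (kerl (idfun : el2char el2_C))) :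
  sub_incl x = 1%g.
Proof. by have := valP x; rewrite inE => /eqP. Qed.

(** The kernel of the identity character is a trivial group but, as an object, not [el2_1]; this and
    [pb_incl_one] translate between the two restrictions. *)
Lemma pb_one_incl (z : T el2_C) :
  pb (incl (idfun : el2char el2_C)) z =
  pb (@one_hom _ el2_1) (pb (@one_hom el2_1 el2_C) z).
Proof.
rewrite -[RHS](pb_comp (@one_hom el2_1 el2_C) (@one_hom _ el2_1)).
by apply: pb_ext => x; exact: ker_sigma.
Qed.

Lemma pb_incl_one (z : T el2_C) :
  pb (@one_hom el2_1 el2_C) z =
  pb (@one_hom el2_1 _) (pb (incl (idfun : el2char el2_C)) z).
Proof.
rewrite -[RHS](pb_comp (incl (idfun : el2char el2_C)) (@one_hom el2_1 _)).
exact: pb_ext.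
Qed.

(** [a] is the image of the unit under multiplication by the Euler class, and the next map of the
    exact sequence kills that image. *)
Lemma euler_one : pb (@one_hom el2_1 el2_C) a = 0.
Proof.
rewrite pb_incl_one; have [_ ker_e _] := pre_eulerP X 0 nt_sigma.
pose u : X (Ob 0) := alg_res X (hbang R el2_C) (alg_unit X).
have : alg_res X (hker idfun 0) (euler_mul (pre_euler X) idfun u) = 0.
  by apply/ker_e; exists u.
move/(congr1 (@tin R X _ _)); rewrite tin0.
rewrite -(@pb_tin _ _ _ _ (incl (idfun : el2char el2_C))) //.
rewrite tin_euler_mul pb_id [tin u]/(1 : T el2_C) mulr1 => ->; exact: pb0.
Qed.

Lemma tin_unit : tin (alg_unit X : X (Ob 0)) = 1 :> T el2_1.
Proof. by apply/esym; apply: tin_res_id => -[]. Qed.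

Lemma inverse_thomP (t : X (Ob (subI 1 (sigma R)))) :
  inverse_thom t <-> pb (@one_hom el2_1 el2_C) (tin t) = 1.
Proof.
rewrite (@pb_tin _ _ _ _ _ _ _ (hone R)) // -tin_unit.
by split=> [->|/tin_inj].
Qed.

Lemma tin_pmul3 (A : el2) (U V W : rrep R A) (k1 k2 k3 k : int)
    (e : k1 + k2 + k3 = k)
    (x : X (Ob (subI k1 U))) (y : X (Ob (subI k2 V))) (z : X (Ob (subI k3 W))) :
  tin (pmul3 e x y z) = tin x * tin y * tin z.
Proof. by rewrite tin_cast !tin_pmul. Qed.

Lemma is_additiveP (t : X (Ob (subI 1 (sigma R)))) :
  is_additive (pre_euler X) t <->
  pb (p1 el2_C el2_C) a * pb mul_hom (tin t) * pb (p2 el2_C el2_C) (tin t)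
    + pb (p1 el2_C el2_C) (tin t) * pb mul_hom a * pb (p2 el2_C el2_C) (tin t)
    + pb (p1 el2_C el2_C) (tin t) * pb mul_hom (tin t) * pb (p2 el2_C el2_C) a
  = 0.
Proof.
rewrite -!tin_euler -!tin_thom; split=> [/(congr1 (@tin R X _ _))|rel].
  by rewrite tin0 !tinD !tin_pmul3.
by apply: tin_inj; rewrite tin0 !tinD !tin_pmul3.
Qed.

Definition oriented_family (t : X (Ob (subI 1 (sigma R))))
  (thom_t : inverse_thom t) (add_t : is_additive (pre_euler X) t) : ring_family :=
  @RingFamily (fun A => total X A) (@pb R X) (@pbD R X) (@pbM R X) (@pb1 R X)
    (@pb_id R X) (@pb_comp R X) (@total_char2 R X) a (tin t) euler_one
    (iffLR (inverse_thomP t) thom_t) (iffLR (is_additiveP t) add_t) euler_reg.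

End OrientedRings.

Section Degrees.
Variable R : realType.

Lemma constI0 (A : el2) : constI R A 0 = 0.
Proof. by apply: ro_of_inj; rewrite val_constI mulr0z. Qed.

Lemma cdeg1E (A : el2) (l : el2char A) k : subI k (chrep R l) = cdeg R [:: l] k.
Proof. by apply: ro_of_inj; rewrite val_cdeg big_seq1. Qed.

Lemma cdeg3E (A : el2) (l m n : el2char A) k :
  subI k (dadd_grepr (dadd_grepr (chrep R l) (chrep R m)) (chrep R n)) =
  cdeg R [:: l; m; n] k.
Proof.
apply: ro_of_inj; rewrite val_cdeg !big_cons big_nil addr0 addrA.
by rewrite -!rclass_dadd.
Qed.

Lemma cdeg_pb_trivial (B A : el2) (f : {multiplicative B -> A}) (l : el2char A)
    (s : seq (el2char A)) k : ~ nontrivial (chpb f l) ->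
  pbI f (cdeg R (l :: s) k) = cdeg R (map (chpb f) s) (k - 1).
Proof. by move=> triv; rewrite cdeg_pb; apply: cdeg_trivial. Qed.

End Degrees.

Section Homogeneity.
Variables (R : realType) (X : orientable_alg R) (t : X (Ob (subI 1 (sigma R)))).
Hypotheses (thom_t : inverse_thom t) (add_t : is_additive (pre_euler X) t).

Lemma etspan_homog (A : el2) (s : seq (el2char A)) k z :
  etspan (F := oriented_family thom_t add_t) s k z ->
  exists x : X (Ob (cdeg R s k)), z = tin x.
Proof.
elim=> {s k z} [k||l s k _ _ _ [x ->] _ [y ->]].
- by exists 0; rewrite tin0.
- exists (castX (esym (constI0 R A)) (alg_res X (hbang R A) (alg_unit X))).
  by rewrite tin_cast.
exists (euler_mul (pre_euler X) l x
  + castX (cdeg_thom R l s k) (pmul (thom t l) y)).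
by rewrite tinD tin_euler_mul tin_cast tin_pmul tin_thom.
Qed.

End Homogeneity.

(** Exactness for the identity character of [C] makes the restriction from degree [1 - sigma] to the
    trivial kernel surjective; a preimage of the unit is an inverse Thom class. *)
Lemma inverse_thom_ex (R : realType) (X : orientable_alg R) :
  exists t : X (Ob (subI 1 (sigma R))), inverse_thom t.
Proof.
have Em' : subI 1 (sigma R) = constI R el2_C 1 + subI 0 (chrep R idfun).
  exact: cdeg1E.
have En : 0 = pbI (@sub_incl _ (kerl (idfun : el2char el2_C))) (subI 1 (sigma R)).
  by rewrite cdeg1E cdeg_pb_trivial ?subrr ?[RHS]constI0 //; apply: incl_ker.
have [t Et] := res_surj (alg_res X (hbang R _) (alg_unit X)) nt_sigma Em' En.
exists t; apply/inverse_thomP; rewrite pb_incl_one Et; exact: pb1.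
Qed.

(** * Bredon algebras *)

Section Bredon.
Variables (R : realType) (H : orientable_alg R).
Hypothesis bredonH : is_bredon H.

Notation neg l := (subI 0 (chrep R l)).
Local Notation T := (total H).
Local Notation a := (tin (pre_euler H) : T el2_C).
Local Notation incl l := (@sub_incl _ (kerl l)).

Lemma bredon_eq0 (A : el2) (m : IRO R A) k (x : H (Ob m)) :
  m = constI R A k -> k != 0 -> x = 0.
Proof. by move=> Em; subst m => k0; apply: (bredonH A).2 k0 _. Qed.

Lemma bredon_one (A : el2) : (1 : T A) <> 0.
Proof.
move=> e10; have [[f [g fK gK]] _] := bredonH A.
have H0 (x : H (Ob (constI R A 0))) : x = 0.
  by apply: tin_inj; rewrite -[LHS]mul1r e10 mul0r tin0.
have /eqP := gK 1; rewrite (H0 (g 1)) raddf0; exact/negP.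
Qed.

Lemma bredon_deg0 (A : el2) (x : H (Ob (constI R A 0))) : tin x = 0 \/ tin x = 1.
Proof.
have [[f /bij_inj f_inj] _] := bredonH A.
pose u := castX (esym (constI0 R A)) (alg_res H (hbang R A) (alg_unit H)).
have Eu : tin u = 1 by rewrite tin_cast.
have F2 (b : 'F_2) : b = 0 \/ b = 1.
  by case: b => [[|[|//]]] ?; [left|right]; apply: val_inj.
have [fx|fx] := F2 (f x); [left|right].
  have -> : x = 0 by apply: f_inj; rewrite fx raddf0.
  exact: tin0.
have [fu|fu] := F2 (f u); last first.
  by rewrite -Eu; congr tin; apply: f_inj; rewrite fx fu.
case: (@bredon_one A); rewrite -Eu.
have -> : u = 0 by apply: f_inj; rewrite fu raddf0.
exact: tin0.
Qed.

(** [t + t'] restricts to 0, hence is the Euler class times an element of [H(C, 1)], which is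
    zero. *)
Lemma bredon_thom_uniq (t t' : H (Ob (subI 1 (sigma R)))) :
  inverse_thom t -> inverse_thom t' -> t = t'.
Proof.
move=> /inverse_thomP Et /inverse_thomP Et'.
have [||x] := @euler_ker _ H _ idfun (constI R el2_C 1) _ (t + t') nt_sigma.
- exact: cdeg1E.
- by rewrite pb_one_incl tinD pbD Et Et' total_char2 pb0.
rewrite (bredon_eq0 x erefl) // tin0 mulr0.
rewrite -(tin0 H (subI 1 (sigma R))) => /tin_inj.
by move=> tt'; apply: (addrI t); rewrite tt' alg_char2.
Qed.

Lemma pb_trivial (A : el2) (l : el2char A) (z : T el2_C) : ~ nontrivial l ->
  pb l z = pb (@one_hom A el2_1) (pb (@one_hom el2_1 el2_C) z).
Proof.
by move/trivial_char->; rewrite -[RHS](pb_comp _ (@one_hom A el2_1)).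
Qed.

(* The additivity relation restricts to 0 on the kernels of [p1], [mul_hom] and
   [p2], so that it is divisible by the three Euler classes; the quotient lies in
   H(C x C, 2) = 0. *)
Lemma bredon_thom_additive (t : H (Ob (subI 1 (sigma R)))) :
  inverse_thom t -> is_additive (pre_euler H) t.
Proof.
move=> thom_t; have /inverse_thomP t1 := thom_t.
pose A := el2_prod el2_C el2_C.
pose l1 : el2char A := p1 el2_C el2_C; pose l2 : el2char A := p2 el2_C el2_C.
pose lm : el2char A := mul_hom.
pose e l := euler (pre_euler H) (l : el2char A).
pose th l := thom t (l : el2char A).
set r := @pmul3 R H A _ _ _ 0 1 1 2 erefl (e l1) (th lm) (th l2)
  + @pmul3 R H A _ _ _ 1 0 1 2 erefl (th l1) (e lm) (th l2)
  + @pmul3 R H A _ _ _ 1 1 0 2 erefl (th l1) (th lm) (e l2).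
have Er : tin r = pb l1 a * pb lm (tin t) * pb l2 (tin t)
    + pb l1 (tin t) * pb lm a * pb l2 (tin t)
    + pb l1 (tin t) * pb lm (tin t) * pb l2 a.
  by rewrite !tinD !tin_pmul3 !tin_euler !tin_thom.
suff r0 : r = 0 by exact: r0.
have e_triv (B : el2) (l : el2char B) : ~ nontrivial l -> pb l a = 0.
  by move=> /pb_trivial->; rewrite euler_one pb0.
have t_triv (B : el2) (l : el2char B) : ~ nontrivial l -> pb l (tin t) = 1.
  by move=> /pb_trivial->; rewrite t1 pb1.
have pb_chpb (B : el2) (f : {multiplicative B -> A}) (l : el2char A)
    (z : T el2_C) : pb f (pb l z) = pb (chpb f l) z by rewrite [RHS]pb_comp.
have r1 : pb (incl l1) (tin r) = 0.
  rewrite Er !pbD !pbM !pb_chpb (e_triv _ _ (@incl_ker A l1)).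
  rewrite (t_triv _ _ (@incl_ker A l1)).
  (* On [ker l1] the characters [lm] and [l2] agree, so the two remaining terms cancel in
     characteristic 2. *)
  have -> : chpb (incl l1) lm = chpb (incl l1) l2.
    apply: multiplicative_eq => x /=; have := valP x; rewrite inE => /eqP x1.
    exact: etrans (congr1 (fun b : el2_C => b * (sgval x).2)%g x1) (mul1g _).
  by rewrite !mul0r !mul1r add0r mulrC total_char2.
have [y Ey] : exists y : H (Ob (cdeg R [:: lm; l2] 2)), tin r = pb l1 a * tin y.
  by apply: euler_ker r1; [exists (true, false)|exact: cdeg3E].
have ym : pb (incl lm) (tin y) = 0.
  have : pb (incl lm) (tin r) = 0.
    rewrite Er !pbD !pbM !pb_chpb (e_triv _ _ (@incl_ker A lm)).
    rewrite (t_triv _ _ (@incl_ker A lm)).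
    have -> : chpb (incl lm) l1 = chpb (incl lm) l2.
      have mul1 (c : A) : lm c == 1%g -> l1 c = l2 c by case: c => -[] [].
      by apply: multiplicative_eq => x; apply: mul1; have := valP x; rewrite inE.
    by rewrite !mulr1 mulr0 mul0r addr0 mulrC total_char2.
  (* The Euler class of [l1] can be cancelled on [ker lm]: this group contains [(true, true)], where
     [l1] is not trivial. *)
  rewrite Ey pbM pb_chpb; apply: euler_reg.
  have tt_ker : ((true, true) : A) \in kerl lm by rewrite inE.
  by exists (Subg tt_ker).
have [y' Ey'] : exists y' : H (Ob (cdeg R [:: l2] 2)), tin y = pb lm a * tin y'.
  by apply: euler_ker ym; [exists (true, false)|].
(* On [ker l2] the degree [2 - l2] becomes the constant 1, where a Bredon algebra vanishes. *)
have y'2 : pb (incl l2) (tin y') = 0.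
  rewrite pb_hpb (bredon_eq0 (k := 1) (alg_res H _ y')) ?tin0 //.
  by rewrite cdeg_pb_trivial //; apply: incl_ker.
have [y'' Ey''] : exists y'' : H (Ob (cdeg R [::] 2)), tin y' = pb l2 a * tin y''.
  by apply: euler_ker y'2; [exists (false, true)|].
apply: tin_inj; rewrite tin0 Ey Ey' Ey'' (bredon_eq0 y'' erefl) // tin0.
by rewrite !mulr0.
Qed.

Variables (F : ring_family) (t : H (Ob (subI 1 (sigma R)))).
Hypothesis thom_t : inverse_thom t.
Let add_t := bredon_thom_additive thom_t.
Let FH := oriented_family thom_t add_t.

(** The polynomial is evaluated in [F] at the same time, which later provides the image of [h]. The
    induction on the length of [s] runs over all groups at once, as restriction to [ker l] keeps the
    length of the tail. *)
Lemma etspan_bredon (A : el2) (s : seq (el2char A)) k (h : H (Ob (cdeg R s k))) :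
  exists2 z : prod_family FH F A, etspan s k z & z.1 = tin h.
Proof.
have [n] := ubnP (size s); elim: n => // n IHn in A s k h *.
case: s h => [|l s] h.
  move=> _; have [Ek|k0] := eqVneq k 0.
    subst k; have [h0|h1] := bredon_deg0 h.
      by exists 0; [exact: ETnil0|rewrite h0].
    by exists 1; [exact: ETnil1|rewrite h1].
  by exists 0; [exact: ETnil0|rewrite (bredon_eq0 h erefl k0) tin0].
rewrite ltnS => lt_sn; have [ntl|trl] := pselect (nontrivial l); last first.
  have [z Gz Ez] := IHn _ s _ (castX (cdeg_trivial R s k trl) h) lt_sn.
  exists (fam_thom _ l * z); first exact: etspan_t.
  by rewrite fam_thom_trivial // mul1r Ez tin_cast.
pose hK := castX (@cdeg_pb_trivial R _ _ _ _ s k (@incl_ker A l))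
  (alg_res H (hpb (incl l) _) h).
have EhK : tin hK = pb (incl l) (tin h) by rewrite tin_cast pb_hpb.
have [|zK GzK EzK] := IHn _ (map (chpb (incl l)) s) _ hK.
  by rewrite size_map.
have [w Gw Ew] := etspan_lift GzK; have [y Ey] := etspan_homog (etspan_prod1 Gw).
(* In characteristic 2 this is [h - t_ l * w], which vanishes on [ker l] since [t_ l] restricts to 1
   there. *)
pose d := h + castX (cdeg_thom R l s k) (pmul (thom t l) y).
have Ed : tin d = tin h + pb l (tin t) * w.1.
  by rewrite tinD tin_cast tin_pmul tin_thom Ey.
have [|x Ex] := @euler_ker _ H A l (cdeg R s k) _ d ntl erefl.
  rewrite Ed pbD pbM -EhK -EzK -Ew [pb (incl l) w.1]/(rpb (incl l) w).1.
  rewrite -[pb (incl l) (pb l (tin t))]/(rpb (incl l) (fam_thom FH l)) rpb_thom.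
  by rewrite (fam_thom_trivial FH (@incl_ker A l)) mul1r [LHS]total_char2.
have [z Gz Ez] := IHn _ s k x lt_sn.
exists (fam_euler _ l * z + fam_thom _ l * w); first exact: ETcons.
pose c : total H A := pb l (tin t) * w.1.
transitivity (tin d + c); first by rewrite Ex -Ez.
by rewrite Ed -/c -addrA total_char2 addr0.
Qed.

End Bredon.

(** * Morphisms *)

Lemma orientable_mor_eq (R : realType) (X X' : orientable_alg R)
    (f g : orientable_mor X X') : (forall Y x, f Y x = g Y x) -> f = g.
Proof.
case: f g => [[f f1 f2 f3 f4] fa] [[g g1 g2 g3 g4] ga] /= eq_fg.
have {}eq_fg : f = g.
  apply: functional_extensionality_dep => Y.
  exact: functional_extensionality_dep.
subst g; rewrite (Prop_irrelevance f1 g1) (Prop_irrelevance f2 g2) in fa *.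
rewrite (Prop_irrelevance f3 g3) (Prop_irrelevance f4 g4) in fa *.
by rewrite (Prop_irrelevance fa ga).
Qed.

(** * Morphisms on total rings *)

Section InducedMap.
Variables (R : realType) (H X : orientable_alg R) (f : orientable_mor H X).

Lemma mor_add Y : {morph f Y : x y / x + y}.
Proof. by move=> x y; rewrite -[in LHS](scale1r x) mor_linear scale1r. Qed.

Definition tmap (A : el2) (z : total H A) : total X A :=
  dlift (fun m x => tin (f (Ob m) x)) z.

Lemma tmap_tin (A : el2) (m : IRO R A) (x : H (Ob m)) :
  tmap (tin x) = tin (f _ x).
Proof. by apply: dlift_din => n y y'; rewrite mor_add tinD. Qed.

Lemma tmapD (A : el2) : {morph @tmap A : z w / z + w}.
Proof. by apply: dliftD => m x y; rewrite mor_add tinD. Qed.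

Lemma tmap0 (A : el2) : @tmap A 0 = 0.
Proof. by apply: (addrI (tmap 0)); rewrite -tmapD !addr0. Qed.

Lemma tmapM (A : el2) : {morph @tmap A : z w / z * w}.
Proof.
move=> z w; elim/total_ind: z => [|z z' IH IH'|m x].
- by rewrite mul0r tmap0 mul0r.
- by rewrite mulrDl !tmapD IH IH' mulrDl.
elim/total_ind: w => [|w w' IH IH'|n y].
- by rewrite mulr0 tmap0 mulr0.
- by rewrite mulrDr !tmapD IH IH' mulrDr.
by rewrite -tin_pmul !tmap_tin -tin_pmul /pmul mor_res mor_mul.
Qed.

Lemma tmap1 (A : el2) : @tmap A 1 = 1.
Proof. by rewrite [LHS]tmap_tin mor_res mor_unit. Qed.

Lemma tmap_pb (B A : el2) (g : {multiplicative B -> A}) (z : total H A) :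
  tmap (pb g z) = pb g (tmap z).
Proof.
elim/total_ind: z => [|z w IH IH'|m x]; first by rewrite !(pb0, tmap0).
  by rewrite !(pbD, tmapD) IH IH'.
by rewrite pb_hpb !tmap_tin pb_hpb mor_res.
Qed.

Lemma tmap_euler : tmap (tin (pre_euler H)) = tin (pre_euler X).
Proof. by rewrite tmap_tin mor_pre_euler. Qed.

Variable t : H (Ob (subI 1 (sigma R))).

Lemma mor_inverse_thom : inverse_thom t -> inverse_thom (f _ t).
Proof.
move=> /inverse_thomP t1; apply/inverse_thomP.
by rewrite -tmap_tin -tmap_pb t1 tmap1.
Qed.

Lemma mor_additive :
  is_additive (pre_euler H) t -> is_additive (pre_euler X) (f _ t).
Proof.
move=> /is_additiveP /(congr1 (@tmap _)); rewrite tmap0 !tmapD !tmapM !tmap_pb.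
by rewrite tmap_euler tmap_tin => /is_additiveP.
Qed.

End InducedMap.

(** * The morphism with a prescribed Thom class *)

Section Classification.
Variables (R : realType) (H X : orientable_alg R).
Hypothesis bredonH : is_bredon H.
Variables (tH : H (Ob (subI 1 (sigma R)))) (t : X (Ob (subI 1 (sigma R)))).
Hypotheses (thom_tH : inverse_thom tH) (thom_t : inverse_thom t).
Hypothesis add_t : is_additive (pre_euler X) t.

Let FH := oriented_family thom_tH (bredon_thom_additive bredonH thom_tH).
Let FX := oriented_family thom_t add_t.
Let F := prod_family FH FX.

(* The graph of the morphism sending [tH] to [t]. *)
Definition graph (A : el2) (m : IRO R A) (h : H (Ob m)) (x : X (Ob m)) : Prop :=
  exists s k, m = cdeg R s k /\ etspan (F := F) s k (tin h, tin x).

Lemma graph_total (A : el2) (m : IRO R A) (h : H (Ob m)) : exists x, graph h x.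
Proof.
have [s [k Em]] := cdeg_surj m; subst m.
have [z Gz Ez] := etspan_bredon bredonH FX thom_tH h.
have [x Ex] := etspan_homog (etspan_prod2 Gz).
exists x, s, k; split=> //; rewrite -Ez -Ex.
by case: z Gz {Ez Ex}.
Qed.

(** The two pairs may come with different presentations of [m]; [etspan_cdeg] carries one to the
    other. *)
Lemma graphD (A : el2) (m : IRO R A) (h h' : H (Ob m)) (x x' : X (Ob m)) :
  graph h x -> graph h' x' -> graph (h + h') (x + x').
Proof.
move=> [s [k [Em Gx]]] [s' [k' [Em' Gx']]]; exists s, k; split=> //.
have := etspanD Gx (etspan_cdeg (etrans (esym Em') Em) Gx').
by rewrite !tinD.
Qed.

(** The two pairs add up to [(0, x + x')], to which [prod_etspan_inj] applies. *)
Lemma graph_uniq (A : el2) (m : IRO R A) (h : H (Ob m)) (x x' : X (Ob m)) :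
  graph h x -> graph h x' -> x = x'.
Proof.
move=> Gx Gx'; have [s [k [_]]] := graphD Gx Gx'.
rewrite alg_char2 tin0 => /prod_etspan_inj-/(_ (bredon_one bredonH) erefl) xx'0.
apply: (addrI x); rewrite alg_char2; apply: tin_inj; rewrite tin0.
exact: esym (congr1 snd xx'0).
Qed.

Definition classify (Y : el2RO R) : H Y -> X Y :=
  let: Ob A m := Y in fun h => projT1 (cid (graph_total h)).

Lemma classifyP (A : el2) (m : IRO R A) (h : H (Ob m)) : graph h (classify h).
Proof. by rewrite /=; case: cid. Qed.

Lemma classify_eq (A : el2) (m : IRO R A) (h : H (Ob m)) x :
  graph h x -> classify h = x.
Proof. exact: graph_uniq (classifyP h). Qed.

Lemma classify_linear Y : linear (@classify Y).
Proof.
case: Y => A m c h h'.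
have [->|->] : c = 0 \/ c = 1.
  by case: c => [[|[|//]]] ?; [left|right]; apply: val_inj.
  by rewrite !scale0r !add0r.
by rewrite !scale1r; apply/classify_eq/graphD; apply: classifyP.
Qed.

Lemma classify_res Y Z (g : el2hom Y Z) h :
  classify (alg_res H g h) = alg_res X g (classify h).
Proof.
case: Y Z g h => [B n] [A m] g h; apply: classify_eq.
have [s [k [Em Gh]]] := classifyP h.
exists (map (chpb g) s), k; split.
  by rewrite -cdeg_pb -Em; exact: esym (hom_deg g).
have := etspan_pb g Gh; congr etspan.
by congr (_, _); apply: pb_tin.
Qed.

Lemma classify_mul Y Z (h : H Y) (h' : H Z) :
  classify (alg_mul H h h') = alg_mul X (classify h) (classify h').
Proof.
case: Y Z h h' => [A m] [B n] h h'; apply: classify_eq.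
have [s [k [Em Gh]]] := classifyP h; have [s' [k' [En Gh']]] := classifyP h'.
have := etspanM (etspan_pb (p1 A B) Gh) (etspan_pb (p2 A B) Gh').
set u := _ ++ _ => Gu; exists u, (k + k'); split.
  by rewrite cdegD -!cdeg_pb Em En.
by rewrite !tin_alg_mul.
Qed.

Lemma classify_unit : classify (alg_unit H) = alg_unit X.
Proof.
apply: classify_eq; exists [::], 0; split; first by rewrite [RHS]constI0.
by rewrite !tin_unit; apply: ETnil1.
Qed.

Lemma classify_euler : classify (pre_euler H) = pre_euler X.
Proof.
apply: classify_eq; exists [:: idfun : el2char el2_C], 0.
split; first exact: cdeg1E.
have := etspan_e (idfun : el2char el2_C) (ETnil1 F el2_C).
by rewrite mulr1 /fam_euler rpb_id.
Qed.

Lemma classify_thom : classify tH = t.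
Proof.
apply: classify_eq; exists [:: idfun : el2char el2_C], 1.
split; first exact: cdeg1E.
have := @etspan_t F _ (idfun : el2char el2_C) [::] 1 1 (ETnil1 F el2_C).
by rewrite mulr1 /fam_thom rpb_id.
Qed.

Definition classify_mor : orientable_mor H X :=
  @OrientableMor _ _ _
    (AlgMor classify_linear classify_res classify_mul classify_unit)
    classify_euler.

(** A morphism that preserves Euler classes and sends [tH] to [t] takes each polynomial in [H] to
    the same polynomial in [X]. *)
Lemma graph_mor (f : orientable_mor H X) (A : el2) (m : IRO R A)
    (h : H (Ob m)) x :
  f _ tH = t -> graph h x -> f _ h = x.
Proof.
move=> ft [s [k [_ Gx]]]; apply: tin_inj; rewrite -tmap_tin.
suff tmapE (z : F A) : etspan s k z -> tmap f z.1 = z.2 by exact: tmapE Gx.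
elim=> {s k z Gx} [k||l s k z w _ IH _ IH'] /=; [exact: tmap0|exact: tmap1|].
rewrite tmapD !tmapM IH IH'.
by rewrite !tmap_pb tmap_euler tmap_tin ft.
Qed.

Lemma mor_classify (f : orientable_mor H X) : f _ tH = t -> f = classify_mor.
Proof.
by move=> ft; apply: orientable_mor_eq => -[A m] h; apply/graph_mor/classifyP.
Qed.

End Classification.

(** * Uniqueness of Bredon algebras *)

Section Uniqueness.
Variables (R : realType).

Definition id_mor (X : orientable_alg R) : orientable_mor X X :=
  @OrientableMor _ X X (@AlgMor _ X X (fun Y x => x) (fun _ _ _ _ => erefl)
    (fun _ _ _ _ => erefl) (fun _ _ _ _ => erefl) erefl) erefl.

Definition comp_alg_mor (X Y Z : el2RO_alg R) (g : alg_mor Y Z)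
  (f : alg_mor X Y) : alg_mor X Z.
Proof.
refine (@AlgMor _ X Z (fun W x => g W (f W x)) _ _ _ _).
- by move=> W c x y; rewrite !mor_linear.
- by move=> V W h x; rewrite !mor_res.
- by move=> V W x y; rewrite !mor_mul.
by rewrite !mor_unit.
Defined.

Lemma comp_mor_euler (X Y Z : orientable_alg R) (g : orientable_mor Y Z)
  (f : orientable_mor X Y) : comp_alg_mor g f _ (pre_euler X) = pre_euler Z.
Proof. by rewrite /= !mor_pre_euler. Qed.

Definition comp_mor (X Y Z : orientable_alg R) (g : orientable_mor Y Z)
  (f : orientable_mor X Y) : orientable_mor X Z :=
  OrientableMor (comp_mor_euler g f).

(** Both morphisms send [tH] to the only inverse Thom class of [H'], and this value determines
    them. *)
Lemma bredon_mor_uniq (H H' : orientable_alg R) (f g : orientable_mor H H') :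
  is_bredon H -> is_bredon H' -> f = g.
Proof.
move=> bH bH'; have [tH thom_tH] := inverse_thom_ex H.
have thom_f := mor_inverse_thom f thom_tH.
have add_f := bredon_thom_additive bH' thom_f.
rewrite (mor_classify bH thom_tH thom_f add_f erefl).
apply/esym/mor_classify; apply: (bredon_thom_uniq bH') => //.
exact: mor_inverse_thom.
Qed.

Lemma bredon_mor_ex (H H' : orientable_alg R) :
  is_bredon H -> is_bredon H' -> exists f : orientable_mor H H', True.
Proof.
move=> bH bH'; have [tH thom_tH] := inverse_thom_ex H.
have [t thom_t] := inverse_thom_ex H'.
by exists (classify_mor bH thom_tH thom_t (bredon_thom_additive bH' thom_t)).
Qed.

End Uniqueness.

Theorem theorem3p5 (R : realType) :
  (forall H X : orientable_alg R, is_bredon H ->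
     exists tH : H (Ob (subI 1 (sigma R))),
       unique (@inverse_thom R H) tH /\
       let ev (f : orientable_mor H X) := f (Ob (subI 1 (sigma R))) tH in
       [/\ forall f, inverse_thom (ev f) /\ is_additive (pre_euler X) (ev f),
           injective ev
         & forall t, inverse_thom t -> is_additive (pre_euler X) t ->
             exists f, ev f = t]) /\
  (forall H H' : orientable_alg R, is_bredon H -> is_bredon H' ->
     exists! f : orientable_mor H H', is_iso f).
Proof.
split=> [H X bH|H H' bH bH'].
  have [tH thom_tH] := inverse_thom_ex H; exists tH.
  have add_tH := bredon_thom_additive bH thom_tH.
  split; first by split=> // t; apply: bredon_thom_uniq.
  split=> [f|f g ev_fg|t thom_t add_t].
  - by split; [apply: mor_inverse_thom|apply: mor_additive].
  - have thom_f := mor_inverse_thom f thom_tH.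
    have add_f := mor_additive f add_tH.
    rewrite (mor_classify bH thom_tH thom_f add_f erefl).
    exact/esym/mor_classify/esym/ev_fg.
  by exists (classify_mor bH thom_tH thom_t add_t); apply: classify_thom.
have [f _] := bredon_mor_ex bH bH'; have [g _] := bredon_mor_ex bH' bH.
exists f; split; last by move=> f' _; apply: bredon_mor_uniq.
exists g => Y; split=> x.
  have E := bredon_mor_uniq (comp_mor g f) (id_mor H) bH bH.
  by have := congr1 (fun u : orientable_mor H H => u Y x) E.
have E := bredon_mor_uniq (comp_mor f g) (id_mor H') bH' bH'.
by have := congr1 (fun u : orientable_mor H' H' => u Y x) E.
Qed.
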